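(* Let $d,\alpha\in\mathbb{N}$ and $a\ge\frac12$. Let $f\in\mathcal H(K_{\alpha,a,d})$ be a probability density on $[-a,a]^d$, and let $\bm Y=\{Y_1,\dots,Y_M\}$ be i.i.d. random vectors with density $f$. Let $N$ be a prime number and $V_N=V_N(X^* )$, where $X^*$ is the scaled lattice point set with $N$ points. For $\lambda\in(0,1)$ let $f^\lambda_{\bm Y}\in V_N(X^* )$ satisfy $$\langle f_{\bm Y}^\lambda,v\rangle_{L^2([-a,a]^d)}+\lambda\langle f_{\bm Y}^\lambda,v\rangle_{K_{\alpha,a,d}}=\frac1M\sum_{m=1}^Mv(Y_m)\quad\text{for all }v\in V_N(X^* ).$$ Then for any $\tau\in(1/(2\alpha),1]$, $\lambda\in(0,1)$ and $\delta\in(0,\alpha/2)$, $$\mathbb{E}\left[\int_{[-a,a]^d}|f_{\bm Y}^\lambda(\bm x)-f(\bm x)|^2d\bm x\right]\le C^2_{\alpha,\delta,d}\frac{(2a)^{2\alpha d}\|f\|^2_{K_{\alpha,a,d}}}{N^{\alpha-2\delta}}+\lambda\|f\|_{K_{\alpha,a,d}}^2+\frac{\left((2a)^{-\tau-1}+\frac1a\left(\frac a\pi\right)^{2\alpha\tau}\zeta(2\alpha\tau)\right)^d}{M\lambda^\tau},$$ where $$C_{\alpha,\delta,d}=\kappa_{\alpha,\delta}\left(\sum_{u\subset\{1,\dots,d\}}\max(|u|,1)\left[2\left(\tfrac1{2\pi}\right)^{\frac{\alpha}{\alpha-2\delta}}\zeta\left(\tfrac{\alpha}{\alpha-2\delta}\right)\right]^{|u|}\right)^{\alpha-2\delta},\quad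 \kappa_{\alpha,\delta}=\sqrt2\max\left\{6,\,2.5+2^{\frac{2\alpha}{\alpha-2\delta}+1}\right\}^{\alpha/2-\delta}.$$
   Context: $\zeta$ is the Riemann zeta function. **Korobov space on a box.** For $a>0$, $\bm h\in\mathbb{Z}^d$, let $\varphi_{a,d,\bm h}(\bm x)=\prod_{j=1}^d\frac{1}{\sqrt{2a}}\exp\big(2\pi i h_j\frac{x_j+a}{2a}\big)$ and $\widehat f_{a,d}(\bm h)=\int_{[-a,a]^d}f\,\overline{\varphi_{a,d,\bm h}}\,d\bm x$. Let $r_{\alpha,a,d}(\bm h)=\prod_j r_{\alpha,a}(h_j)$, with $r_{\alpha,a}(0)=\sqrt{2a}$ and $r_{\alpha,a}(h)=|\pi h/a|^\alpha$ for $h\ne0$. $\mathcal H(K_{\alpha,a,d})$ is the reproducing kernel Hilbert space of functions on $[-a,a]^d$ with inner product $\langle f,g\rangle_{K_{\alpha,a,d}}=\sum_{\bm h\in\mathbb{Z}^d}\widehat f_{a,d}(\bm h)\overline{\widehat g_{a,d}(\bm h)}\,r_{\alpha,a,d}(\bm h)^2$ and kernel $K_{\alpha,a,d}(\bm x,\bm y)=\sum_{\bm h}r_{\alpha,a,d}(\bm h)^{-2}\varphi_{a,d,\bm h}(\bm x)\overline{\varphi_{a,d,\bm h}(\bm y)}$. **Lattice points.** Let $r_{\alpha,s}(\bm h)=\prod_{j=1}^s r_\alpha(h_j)$, $r_\alpha(0)=1$, $r_\alpha(h)=|2\pi h|^\alpha$ for $h\neq0$. $\mathcal H(K_{\alpha,d})$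 is the RKHS of functions on $[0,1]^d$ with norm $\|f\|_{K_{\alpha,d}}^2=\sum_{\bm h\in\mathbb{Z}^d}|\widehat f(\bm h)|^2r_{\alpha,d}(\bm h)^2$ ($\widehat f$ the usual Fourier coefficients on $[0,1]^d$). For $N$ prime, the component-by-component (CBC) generating vector $\bm z^*=(z_1^*,\dots,z_d^* )$ is obtained by choosing successively, for $s=1,\dots,d$, $z_s^*\in\{1,\dots,N-1\}$ minimizing over $z_s$ the quantity $\mathcal S_s(z_1^*,\dots,z_{s-1}^*,z_s)$, where $$\mathcal S_s(\bm z)=\sum_{\bm h\in\mathbb{Z}^s}\ \sum_{\bm\ell\in\mathbb{Z}^s\setminus\{\bm 0\},\ \bm\ell\cdot\bm z\equiv0\ (\mathrm{mod}\ N)}r_{\alpha,s}(\bm h)^{-2}r_{\alpha,s}(\bm h+\bm\ell)^{-2}.$$ Put $Z^*=\{\bm y_k^*=\{k\bm z^*/N\}:k=1,\dots,N\}$ (componentwise fractional part). The lattice algorithm is $B_N^*(h)(\bm y)=\sum_{\bm h:\,r_{\alpha,d}(\bm h)^2\le T}\Big(\frac1N\sum_{k=1}^N h(\bm y_k^* )e^{-2\pi i\bm h\cdot\bm y_k^*}\Big)e^{2\pi i\bm h\cdot\bm y}$ with $T=\mathcal S_d(\bm z^* )^{-1/2}$. Known result (Cools, Kuo, Nuyens, Sloan), taken as given: $\|h-B_N^*(h)\|_{L^2([0,1]^d)}\le C_{\alpha,\delta,d}\|h\|_{K_{\alpha,d}}N^{-(\alpha/2-\delta)}$ for all $h\in\mathcal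 H(K_{\alpha,d})$, $\delta\in(0,\alpha/2)$, with $C_{\alpha,\delta,d}$ as displayed in the claim. The scaled lattice point set is $X^*=\{2a\bm y-(a,\dots,a)^\top:\bm y\in Z^*\}=\{\bm x_1,\dots,\bm x_N\}\subset[-a,a]^d$, and $V_N(X^* )=\mathrm{span}\{K_{\alpha,a,d}(\bm x_k,\cdot):k=1,\dots,N\}$. *)

(* Defs.v *)
From HB Require Import structures.
From mathcomp Require Import all_boot all_order all_algebra.
From mathcomp Require Import all_classical all_reals all_analysis.
From mathcomp Require Import complex.

Set Implicit Arguments.
Unset Strict Implicit.
Unset Printing Implicit Defensive.

Import Order.TTheory GRing.Theory Num.Theory.
Import numFieldNormedType.Exports.

Local Open Scope classical_set_scope.
Local Open Scope ring_scope.

(* leb R n, the Lebesgue measure on R^n = n.-tuple R, is built by induction   *)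
(* on n from the binary product of measures. The library puts                *)
(* lebesgue_measure on measurableTypeR R, whence the type of tcons.          *)
Definition tcons (R : realType) (n : nat) (p : measurableTypeR R * n.-tuple R) :
  n.+1.-tuple R := [tuple of (p.1 : R) :: p.2].

Definition tuncons (R : realType) (n : nat) (t : n.+1.-tuple R) :
  measurableTypeR R * n.-tuple R := (thead t, [tuple of behead t]).

Lemma measurable_tcons (R : realType) (n : nat) :
  measurable_fun setT (@tcons R n).
Proof. by apply: (@measurable_cons _ _ _ _ fst n snd). Qed.

Lemma measurable_tuncons (R : realType) (n : nat) :
  measurable_fun setT (@tuncons R n).
Proof.
apply/measurable_fun_pairP; split; last exact: measurable_behead.
exact: measurable_tnth.
Qed.

Section cons_measure.
Context (R : realType) (n : nat).
Variable mu : {sigma_finite_measure set (n.-tuple R) -> \bar R}.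

Definition cons_measure : set (n.+1.-tuple R) -> \bar R :=
  pushforward (lebesgue_measure \x mu)%E (@tcons R n).

Let cons_measure_is_measure : {measure set (n.+1.-tuple R) -> \bar R} :=
  measure_function_pushforward__canonical__measure_function_Measure
    (lebesgue_measure \x mu)%E (@measurable_tcons R n).

Let cons_measure0 : cons_measure set0 = 0%E.
Proof. exact: (measure0 cons_measure_is_measure). Qed.

Let cons_measure_ge0 A : (0 <= cons_measure A)%E.
Proof. exact: (measure_ge0 cons_measure_is_measure). Qed.

Let cons_measure_sigma_additive : semi_sigma_additive cons_measure.
Proof. exact: (@measure_semi_sigma_additive _ _ _ cons_measure_is_measure). Qed.

HB.instance Definition _ := isMeasure.Build _ _ _ cons_measure
  cons_measure0 cons_measure_ge0 cons_measure_sigma_additive.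

Lemma cons_measure_sigma_finite : sigma_finite setT cons_measure.
Proof.
have /sigma_finiteP[F [TF ndF Foo]] := sigma_finiteT (@lebesgue_measure R).
have /sigma_finiteP[G [TG ndG Goo]] := sigma_finiteT mu.
have tunconsK p : tuncons (@tcons R n p) = p.
  by case: p => x t; rewrite /tuncons /tcons/=; congr pair; exact/val_inj.
exists (fun k => @tuncons R n @^-1` (F k `*` G k)).
  apply/esym/seteqP; split => // t _.
  have [i _ Fi] : (\bigcup_i F i) (tuncons t).1 by rewrite -TF.
  have [j _ Gj] : (\bigcup_i G i) (tuncons t).2 by rewrite -TG.
  exists (maxn i j) => //; split.
    by move: Fi; exact/subsetPset/ndF/leq_maxl.
  by move: Gj; exact/subsetPset/ndG/leq_maxr.
move=> k; have [mFk Fkoo] := Foo k; have [mGk Gkoo] := Goo k; split.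
  rewrite -[X in measurable X]setTI; apply: measurable_tuncons => //.
  exact: measurableX.
rewrite /cons_measure /pushforward -comp_preimage.
rewrite (_ : _ \o _ = id) ?preimage_id; last by apply/funext => p; exact: tunconsK.
by rewrite product_measure1E// lte_mul_pinfty// ge0_fin_numE.
Qed.

HB.instance Definition _ :=
  Measure_isSigmaFinite.Build _ _ _ cons_measure cons_measure_sigma_finite.

End cons_measure.

Fixpoint leb (R : realType) (n : nat) :
    {sigma_finite_measure set (n.-tuple R) -> \bar R} :=
  match n return {sigma_finite_measure set (n.-tuple R) -> \bar R} with
  | 0 => \d_([tuple] : 0.-tuple R)
  | n'.+1 => cons_measure (leb R n')
  end.

Lemma leb_rect (R : realType) (n : nat) (A : 'I_n -> set R) :
  (forall i, measurable (A i)) ->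
  leb R n [set x | forall i, A i (tnth x i)] =
  (\prod_(i < n) lebesgue_measure (A i))%E.
Proof.
elim: n A => [|n IHn] A mA.
  rewrite big_ord0 /= /dirac indicE mem_set//=.
  by case.
have mB : measurable [set x : n.-tuple R | forall i, A (lift ord0 i) (tnth x i)].
  rewrite (_ : [set _ | _] = \bigcap_(i in [set: 'I_n])
      ((fun x : n.-tuple R => tnth x i) @^-1` A (lift ord0 i))).
    apply: fin_bigcap_measurable => // i _.
    by rewrite -[X in measurable X]setTI; exact: measurable_tnth.
  by apply/seteqP; split=> x /= Ax => [i _|i]; exact: Ax.
rewrite big_ord_recl -IHn// -product_measure1E//=.
rewrite /cons_measure /pushforward; congr product_measure1.
apply/seteqP; split=> -[x t] /=.
  move=> At; split; first exact: (At ord0).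
  by move=> i; have := At (lift ord0 i); rewrite tnthS.
move=> [Ax At] i; case: (unliftP ord0 i) => [j ->|->]; last exact: Ax.
by rewrite tnthS; exact: At.
exact: mA.
Qed.

Local Open Scope complex_scope.

Definition expi (R : realType) (t : R) : R[i] := cos t +i* sin t.

Definition sqabs (R : realType) (w : R[i]) : R :=
  complex.Re w ^+ 2 + complex.Im w ^+ 2.

(* Unconditional sums, meaningful for absolutely summable families.          *)
Definition rsum (R : realType) (I : choiceType) (F : I -> R) : R :=
  fine (\esum_(i in [set: I]) (F^\+ i)%:E - \esum_(i in [set: I]) (F^\- i)%:E)%E.

Definition csum (R : realType) (I : choiceType) (F : I -> R[i]) : R[i] :=
  rsum (fun i => complex.Re (F i)) +i* rsum (fun i => complex.Im (F i)).

Definition cintegral (R : realType) (d : nat) (D : set (d.-tuple R))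
    (g : d.-tuple R -> R[i]) : R[i] :=
  (\int[leb R d]_(x in D) complex.Re (g x))
  +i* (\int[leb R d]_(x in D) complex.Im (g x)).

Definition l2inner (R : realType) (d : nat) (D : set (d.-tuple R))
    (f g : d.-tuple R -> R[i]) : R[i] :=
  cintegral D (fun x => f x * (g x)^*).

Definition l2norm (R : realType) (d : nat) (D : set (d.-tuple R))
    (f : d.-tuple R -> R[i]) : R :=
  Num.sqrt (\int[leb R d]_(x in D) sqabs (f x)).

(* A Korobov space is determined by a domain D, an orthonormal system e of   *)
(* L^2(D) indexed by Z^d = 'rV[int]_d, and weights r. Functions are defined  *)
(* on the whole of R^d but only their values on D matter here.               *)
Section korobov.
Context (R : realType) (d : nat).
Variables (D : set (d.-tuple R)) (e : 'rV[int]_d -> d.-tuple R -> R[i])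
  (r : 'rV[int]_d -> R).
Implicit Types f g : d.-tuple R -> R[i].

Definition fcoef f (h : 'rV[int]_d) : R[i] := l2inner D f (e h).

Definition kinner f g : R[i] :=
  csum (fun h => fcoef f h * (fcoef g h)^* * (r h ^+ 2)%:C).

Definition ksqnorm f : \bar R :=
  \esum_(h in [set: 'rV[int]_d]) (sqabs (fcoef f h) * r h ^+ 2)%:E.

Definition knorm f : R := Num.sqrt (fine (ksqnorm f)).

Definition kkernel (x y : d.-tuple R) : R[i] :=
  csum (fun h => (r h ^- 2)%:C * e h x * (e h y)^*).

(* The functions of finite norm for which the reproducing property holds.    *)
Definition in_rkhs f : Prop :=
  (ksqnorm f < +oo)%E /\
  forall x, D x -> f x = kinner f (fun y => kkernel y x).

End korobov.

Section box.
Context (R : realType).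
Variables (alpha : nat) (a : R).

Definition box (d : nat) : set (d.-tuple R) :=
  [set x | forall j, - a <= tnth x j <= a].

Definition phi (d : nat) (h : 'rV[int]_d) (x : d.-tuple R) : R[i] :=
  \prod_(j < d) ((Num.sqrt (2 * a))^-1%:C *
    expi (2 * pi * (h 0 j)%:~R * ((tnth x j + a) / (2 * a)))).

Definition rbox1 (h : int) : R :=
  if h == 0 then Num.sqrt (2 * a) else `|pi * h%:~R / a| ^+ alpha.

Definition rbox (d : nat) (h : 'rV[int]_d) : R := \prod_(j < d) rbox1 (h 0 j).

End box.

Arguments box {R} a {d}.
Arguments phi {R} a {d}.
Arguments rbox {R} alpha a {d}.

(* H(K_{alpha,a,d}): membership, inner product and norm. *)
Section box_space.
Context (R : realType) (alpha : nat) (a : R) (d : nat).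
Implicit Types f g : d.-tuple R -> R[i].

Definition Kbox : d.-tuple R -> d.-tuple R -> R[i] :=
  kkernel (phi a) (rbox alpha a).
Definition Hbox f : Prop := in_rkhs (box a) (phi a) (rbox alpha a) f.
Definition Hbox_inner f g : R[i] := kinner (box a) (phi a) (rbox alpha a) f g.
Definition Hbox_norm f : R := knorm (box a) (phi a) (rbox alpha a) f.

End box_space.

Section unit_box.
Context (R : realType).
Variable alpha : nat.

Definition unit_box (d : nat) : set (d.-tuple R) :=
  [set y | forall j, 0 <= tnth y j <= 1].

Definition dot (d : nat) (h : 'rV[int]_d) (y : d.-tuple R) : R :=
  \sum_(j < d) (h 0 j)%:~R * tnth y j.

Definition epi (d : nat) (h : 'rV[int]_d) (y : d.-tuple R) : R[i] :=
  expi (2 * pi * dot h y).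

Definition r1 (h : int) : R :=
  if h == 0 then 1 else `|2 * pi * h%:~R| ^+ alpha.

Definition rweight (d : nat) (h : 'rV[int]_d) : R := \prod_(j < d) r1 (h 0 j).

End unit_box.

Arguments unit_box {R d}.
Arguments epi {R d}.
Arguments rweight {R} alpha {d}.

(* H(K_{alpha,d}): membership and norm. *)
Section unit_space.
Context (R : realType) (alpha d : nat).
Implicit Types g : d.-tuple R -> R[i].

Definition Hunit g : Prop := in_rkhs unit_box epi (rweight alpha) g.
Definition Hunit_norm g : R := knorm unit_box epi (rweight alpha) g.

End unit_space.

Section lattice.
Context (R : realType).
Variables (alpha N : nat).

(* The generating vector of dimension s is given by the first s terms of z.  *)
Definition idot (s : nat) (l : 'rV[int]_s) (z : seq nat) : int :=
  \sum_(j < s) l 0 j * (nth 0%N z j)%:Z.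

Definition cbc_sum (s : nat) (z : seq nat) : \bar R :=
  \esum_(h in [set: 'rV[int]_s])
    \esum_(l in [set l : 'rV[int]_s | l != 0 /\ (idot l z = 0 %[mod N])%Z])
      (rweight alpha h ^- 2 * rweight alpha (h + l) ^- 2)%:E.

Definition cbc_vector (d : nat) (z : d.-tuple nat) : Prop :=
  forall s : 'I_d, (1 <= tnth z s <= N.-1)%N /\
    forall w : nat, (1 <= w <= N.-1)%N ->
      (cbc_sum s.+1 (take s.+1 z) <= cbc_sum s.+1 (rcons (take s z) w))%E.

Definition frac (x : R) : R := x - (Num.floor x)%:~R.

(* The index k : 'I_N stands for k + 1 in the usual numbering 1, ..., N.     *)
Definition lattice_point (d : nat) (z : d.-tuple nat) (k : 'I_N) : d.-tuple R :=
  [tuple frac (k.+1%:R * (tnth z j)%:R / N%:R) | j < d].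

Definition lattice_alg (d : nat) (z : d.-tuple nat) (g : d.-tuple R -> R[i])
    (y : d.-tuple R) : R[i] :=
  let T := fine (cbc_sum d z) `^ (- 2^-1) in
  \sum_(h \in [set h : 'rV[int]_d | rweight alpha h ^+ 2 <= T])
    (N%:R^-1 * \sum_(k < N)
       g (lattice_point z k) * expi (- (2 * pi * dot h (lattice_point z k))))
    * epi h y.

Definition scaled_point (a : R) (d : nat) (z : d.-tuple nat) (k : 'I_N) :
    d.-tuple R :=
  [tuple 2 * a * tnth (lattice_point z k) j - a | j < d].

(* The kernel is real valued and V_N is a real span: the equation defining    *)
(* the estimator has v(Y_m), without conjugation, on its right-hand side.    *)
(* The formula for the kernel extends v periodically outside the box.        *)
Definition VN (a : R) (d : nat) (z : d.-tuple nat) :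
    set (d.-tuple R -> R[i]) :=
  [set v | exists c : 'I_N -> R, v = fun x =>
    \sum_(k < N) (c k)%:C * Kbox alpha a (scaled_point a z k) x].

End lattice.

(* Riemann's zeta function at real s > 1.                                    *)
Definition zeta (R : realType) (s : R) : R :=
  limn (series (fun n => n.+1%:R `^ (- s))).

Section constants.
Context (R : realType).
Variables (alpha : nat) (delta : R).

Definition kappa : R :=
  Num.sqrt 2 *
  Num.max 6 (5 / 2 + 2 `^ (2 * alpha%:R / (alpha%:R - 2 * delta) + 1))
    `^ (alpha%:R / 2 - delta).

Definition Ccst (d : nat) : R :=
  let t := alpha%:R / (alpha%:R - 2 * delta) in
  kappa *
  (\sum_(u : {set 'I_d})
     (maxn #|u| 1)%:R * (2 * (1 / (2 * pi)) `^ t * zeta t) ^+ #|u|)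
    `^ (alpha%:R - 2 * delta).

End constants.

(* The worst-case error bound of Cools, Kuo, Nuyens and Sloan for the lattice *)
(* algorithm with generating vector z.                                       *)
Definition lattice_error_bound (R : realType) (alpha N d : nat)
    (z : d.-tuple nat) (delta : R) : Prop :=
  forall g : d.-tuple R -> R[i],
    Hunit alpha g ->
    l2norm unit_box (fun y => g y - lattice_alg alpha N z g y)
    <= Ccst alpha delta d * Hunit_norm alpha g *
       N%:R `^ (- (alpha%:R / 2 - delta)).

Definition is_density_on (R : realType) (d : nat) (D : set (d.-tuple R))
    (f : d.-tuple R -> R) : Prop :=
  (forall x, D x -> 0 <= f x) /\ (\int[leb R d]_(x in D) (f x)%:E = 1)%E.

Definition has_density_on (R : realType) (d : nat) dO
    (Omega : measurableType dO) (P : probability Omega R)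
    (D : set (d.-tuple R)) (f : d.-tuple R -> R)
    (Y : {RV P >-> d.-tuple R}) : Prop :=
  forall A, measurable A ->
    (distribution P Y A = \int[leb R d]_(x in A `&` D) (f x)%:E)%E.

Definition mutually_independent (R : realType) dO dT
    (Omega : measurableType dO) (T : measurableType dT)
    (P : probability Omega R) (M : nat) (Y : 'I_M -> {RV P >-> T}) : Prop :=
  forall (J : {set 'I_M}) (A : 'I_M -> set T), (forall m, measurable (A m)) ->
    (P [set w | forall m, m \in J -> A m (Y m w)] =
     \prod_(m in J) P (Y m @^-1` A m))%E.

(* Main.v *)
Require Import Defs.
From HB Require Import structures.
From mathcomp Require Import all_boot all_order all_algebra.
From mathcomp Require Import all_classical all_reals all_analysis.
From mathcomp Require Import complex measurable_realfun.
From mathcomp Require Import ring lra.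

Set Implicit Arguments.
Unset Strict Implicit.
Unset Printing Implicit Defensive.

Import Order.TTheory GRing.Theory Num.Theory.
Import numFieldNormedType.Exports.

Local Open Scope classical_set_scope.
Local Open Scope complex_scope.
(* opened last, so that [^*] is everywhere the conjugation of closed fields *)
Local Open Scope ring_scope.

Import ComplexField.Normc.

(** Write [L] and [K] for the inner products of L^2 on the box and of the Korobov
    space, and [B = L + lambda K]. The bound is a bias-variance decomposition for
    regularized least squares in the span [VN] of the kernel sections at the
    lattice points.

    Let [e_1, ..., e_m] be a [B]-orthonormal basis of [VN] ([orthonormal_basis]).
    The variational equation says that the coordinates of the estimator are the
    averages of [e_i] over the sample. Their common mean is the L^2 inner product
    of the density [f] with [e_i] ([Rintegral_density]), so the estimator
    fluctuates around [mean_fit], the solution of the same equation with the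
    empirical mean replaced by the integral against [f].

    Variance. In the norm of [B], which dominates the L^2 norm, the mean squared
    fluctuation is by independence at most [1 / M] times the mean of
    [\sum_i e_i (Y_m) ^ 2] ([mean_square_average]). At any point this sum is the
    square of the norm of the evaluation functional on [VN], hence at most its
    square norm on the whole space, [(2 a)^(- d) \sum_h 1 / (1 + lambda r_h^2)]
    ([christoffel_le]). As [1 + y >= y^tau] for [tau] in [[0, 1]], this is at most
    [lambda^(- tau) (2 a)^(- d) \sum_h r_h^(- 2 tau)], a product over coordinates
    of one-dimensional sums that are expressed with the zeta function
    ([effective_dimension_le]).

    Bias. [mean_fit] minimizes [L (v - f, v - f) + lambda K (v, v)] over [VN]
    ([mean_fit_min]); compare it with the [K]-orthogonal projection [p] of [f]
    ([interpolant]). The norm of [p] is at most the norm of [f], which gives the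
    term [lambda |f|^2]. By the reproducing property [f - p] vanishes at the
    lattice points; the lattice algorithm, which only sees the values there, maps
    it to zero, and the worst-case bound for the algorithm, transported from the
    unit cube to the box, becomes a bound on the L^2 norm of [f - p]
    ([l2_le_of_vanishing]).

    The computations take place on Fourier coefficients. All functions involved
    have absolutely summable coefficients in an orthonormal system of bounded
    functions, for which Parseval's identity and the pointwise convergence of the
    series only require exchanging an integral with a dominated sum
    ([Rintegral_rsum]). *)

(** * Unconditional real sums *)

Section real_sums.
Context (R : realType) (I : choiceType).
Implicit Types (F G : I -> R).

Definition rsummable F := (\esum_(i in [set: I]) `|F i|%:E < +oo)%E.

Lemma rsummable_le F G : (forall i, `|F i| <= G i) -> rsummable G -> rsummable F.
Proof.
move=> FG; apply: le_lt_trans; apply: le_esum => i _.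
by rewrite lee_fin (le_trans (FG i))// ler_norm.
Qed.

Lemma rsummable_ge0 F : (forall i, 0 <= F i) ->
  (\esum_(i in [set: I]) (F i)%:E < +oo)%E -> rsummable F.
Proof.
move=> F0; apply: le_lt_trans; apply: le_esum => i _.
by rewrite ger0_norm.
Qed.

Lemma rsummable_norm F : rsummable F -> rsummable (fun i => `|F i|).
Proof.
by apply: le_lt_trans; apply: le_esum => i _; rewrite normr_id.
Qed.

Lemma rsummableD F G : rsummable F -> rsummable G ->
  rsummable (fun i => F i + G i).
Proof.
move=> sF sG; apply: le_lt_trans (lte_add_pinfty sF sG).
rewrite -esumD; do ?by move=> i _; rewrite lee_fin.
by apply: le_esum => i _; rewrite lee_fin ler_normD.
Qed.

(** Finite sums give one inequality; applied to the inverse factor, it gives the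
    reverse one. *)
Lemma esumZl (k : R) (a : I -> \bar R) : 0 <= k -> (forall i, 0 <= a i)%E ->
  (\esum_(i in [set: I]) (k%:E * a i) = k%:E * \esum_(i in [set: I]) a i)%E.
Proof.
have le (k' : R) (b : I -> \bar R) : 0 <= k' -> (forall i, 0 <= b i)%E ->
    (\esum_(i in [set: I]) (k'%:E * b i) <= k'%:E * \esum_(i in [set: I]) b i)%E.
  move=> k0 b0; apply: ge_ereal_sup => _ [X [finX _] <-].
  rewrite -ge0_mule_fsumr//; apply: lee_pmul => //.
    by rewrite fsume_ge0.
  by apply: ereal_sup_ubound; exists X.
move=> k0 a0; apply/eqP; rewrite eq_le le//=.
have [->|kn0] := eqVneq k 0.
  by rewrite mul0e esum_ge0// => i _; rewrite mul0e.
have {}k0 : 0 < k by rewrite lt_def kn0.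
rewrite -lee_pdivlMl// (le_trans _ (le _ _ _ _))//.
- by apply: le_esum => i _; rewrite muleA -EFinM mulVf ?gt_eqF// mul1e.
- by rewrite invr_ge0 ltW.
- by move=> i; rewrite mule_ge0// lee_fin ltW.
Qed.

Lemma rsummableZ k F : rsummable F -> rsummable (fun i => k * F i).
Proof.
rewrite /rsummable => sF.
under eq_esum do rewrite normrM EFinM.
rewrite esumZl// lte_mul_pinfty// ge0_fin_numE// esum_ge0// => i _.
Qed.

Lemma esum_fin F : rsummable F -> (forall i, 0 <= F i) ->
  \esum_(i in [set: I]) (F i)%:E \is a fin_num.
Proof.
move=> sF F0; rewrite ge0_fin_numE ?esum_ge0//; last by move=> i _; rewrite lee_fin.
by apply: le_lt_trans sF; apply: le_esum => i _; rewrite lee_fin ler_norm.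
Qed.

(** The positive and negative parts in the definition of [rsum] may be replaced
    by any decomposition into summable nonnegative families: this is what makes
    [rsum] linear. *)
Lemma rsumB_ge0 F G : rsummable F -> rsummable G ->
  (forall i, 0 <= F i) -> (forall i, 0 <= G i) ->
  rsum (fun i => F i - G i) =
  fine (\esum_(i in [set: I]) (F i)%:E) - fine (\esum_(i in [set: I]) (G i)%:E).
Proof.
move=> sF sG F0 G0; rewrite /rsum -fineB ?esum_fin//; congr fine.
rewrite -(@esumB _ _ [set: I] (EFin \o F) (EFin \o G))//; last 2 first.
- by move=> i _; rewrite lee_fin.
- by move=> i _; rewrite lee_fin.
congr (_ - _)%E; apply: eq_esum => i _.
  by rewrite funeposE EFin_max.
by rewrite funenegE EFin_max.
Qed.

Lemma eq_rsum F G : F =1 G -> rsum F = rsum G.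
Proof. by move=> /funext ->. Qed.

Lemma rsummable0 : rsummable (fun=> 0).
Proof. by rewrite /rsummable esum1// => i _; rewrite normr0. Qed.

Lemma rsum_ge0E F : rsummable F -> (forall i, 0 <= F i) ->
  rsum F = fine (\esum_(i in [set: I]) (F i)%:E).
Proof.
move=> sF F0; have := rsumB_ge0 sF rsummable0 F0 (fun=> lexx _).
rewrite [X in _ - fine X](esum1)// subr0 => <-.
by apply: eq_rsum => i; rewrite subr0.
Qed.

Lemma EFin_rsum F : rsummable F -> (forall i, 0 <= F i) ->
  (rsum F)%:E = \esum_(i in [set: I]) (F i)%:E.
Proof. by move=> sF F0; rewrite rsum_ge0E// fineK// esum_fin. Qed.

Lemma rsum0 : rsum (fun _ : I => 0 : R) = 0.
Proof. by rewrite rsum_ge0E//=; [rewrite esum1|exact: rsummable0]. Qed.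

Lemma rsum_ge0 F : rsummable F -> (forall i, 0 <= F i) -> 0 <= rsum F.
Proof.
move=> sF F0; rewrite rsum_ge0E// fine_ge0// esum_ge0// => i _.
by rewrite lee_fin.
Qed.

Let pos F i : R := Num.max (F i) 0.
Let neg F i : R := Num.max (- F i) 0.
Let posneg F i : F i = pos F i - neg F i.
Proof. by rewrite /pos /neg; case: (leP (F i) 0); case: (leP (- F i) 0); lra. Qed.
Let pos_ge0 F i : 0 <= pos F i. Proof. by rewrite /pos le_max lexx orbT. Qed.
Let neg_ge0 F i : 0 <= neg F i. Proof. by rewrite /neg le_max lexx orbT. Qed.
Let spos F : rsummable F -> rsummable (pos F).
Proof.
move=> /rsummable_norm; apply: rsummable_le => i.
by rewrite ger0_norm// /pos ge_max ler_norm normr_ge0.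
Qed.
Let sneg F : rsummable F -> rsummable (neg F).
Proof.
move=> /rsummable_norm; apply: rsummable_le => i.
by rewrite ger0_norm// /neg ge_max normr_ge0 -normrN ler_norm.
Qed.
Let esumDr F G : (forall i, 0 <= F i) -> (forall i, 0 <= G i) ->
  rsummable F -> rsummable G ->
  fine (\esum_(i in [set: I]) (F i + G i)%:E) =
  fine (\esum_(i in [set: I]) (F i)%:E) + fine (\esum_(i in [set: I]) (G i)%:E).
Proof.
move=> F0 G0 sF sG; rewrite -fineD ?esum_fin// -esumD//;
  by move=> i _; rewrite lee_fin.
Qed.

Let esumZr (k : R) F : 0 <= k -> (forall i, 0 <= F i) -> rsummable F ->
  fine (\esum_(i in [set: I]) (k * F i)%:E) =
  k * fine (\esum_(i in [set: I]) (F i)%:E).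
Proof.
move=> k0 F0 sF; under eq_esum do rewrite EFinM.
rewrite esumZl//.
by rewrite fineM ?esum_fin.
Qed.

Lemma rsumD F G : rsummable F -> rsummable G ->
  rsum (fun i => F i + G i) = rsum F + rsum G.
Proof.
move=> sF sG.
have -> : rsum (fun i => F i + G i) =
    rsum (fun i => (pos F i + pos G i) - (neg F i + neg G i)).
  by apply: eq_rsum => i; rewrite {1}(posneg F i) {1}(posneg G i) opprD addrACA.
rewrite (eq_rsum (posneg F)) (eq_rsum (posneg G)).
rewrite (rsumB_ge0 (spos sF) (sneg sF))// (rsumB_ge0 (spos sG) (sneg sG))//.
rewrite rsumB_ge0//; last 4 first.
- exact: rsummableD (spos sF) (spos sG).
- exact: rsummableD (sneg sF) (sneg sG).
- by move=> i; rewrite addr_ge0.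
- by move=> i; rewrite addr_ge0.
rewrite (esumDr _ _ (spos sF) (spos sG))// (esumDr _ _ (sneg sF) (sneg sG))//.
by rewrite opprD addrACA.
Qed.

Lemma rsumZ k F : rsummable F -> rsum (fun i => k * F i) = k * rsum F.
Proof.
have ge0 (k' : R) G : 0 <= k' -> rsummable G ->
    rsum (fun i => k' * G i) = k' * rsum G.
  move=> k0 sF.
  have -> : rsum (fun i => k' * G i) = rsum (fun i => k' * pos G i - k' * neg G i).
    by apply: eq_rsum => i; rewrite {1}(posneg G i) mulrBr.
  rewrite (eq_rsum (posneg G)) (rsumB_ge0 (spos sF) (sneg sF))//.
  rewrite (rsumB_ge0 (rsummableZ k' (spos sF)) (rsummableZ k' (sneg sF))); last 2 first.
  - by move=> i; rewrite mulr_ge0.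
  - by move=> i; rewrite mulr_ge0.
  rewrite mulrBr; congr (_ - _).
    exact: esumZr (spos sF).
  exact: esumZr (sneg sF).
have N G : rsummable G -> rsum (fun i => - G i) = - rsum G.
  move=> sG; apply/eqP; rewrite eq_sym -subr_eq0 -opprD oppr_eq0 -rsumD//.
    by apply/eqP; rewrite -[RHS]rsum0; apply: eq_rsum => i; rewrite subrr.
  by apply: rsummable_le (rsummable_norm sG) => i; rewrite normrN.
move=> sF; have [k0|/ltW k0] := leP 0 k; first exact: ge0.
rewrite -[k]opprK mulNr -ge0 ?oppr_ge0// -N; last exact: rsummableZ.
by apply: eq_rsum => i; rewrite mulNr.
Qed.

Lemma rsumN F : rsummable F -> rsum (fun i => - F i) = - rsum F.
Proof.
move=> sF; rewrite -[RHS]mulN1r -rsumZ//.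
by apply: eq_rsum => i; rewrite mulN1r.
Qed.

Lemma rsummableN F : rsummable F -> rsummable (fun i => - F i).
Proof. by move/rsummable_norm; apply: rsummable_le => i; rewrite normrN. Qed.

Lemma le_rsum F G : rsummable F -> rsummable G ->
  (forall i, F i <= G i) -> rsum F <= rsum G.
Proof.
move=> sF sG FG; rewrite -subr_ge0 -rsumN// -rsumD//; last exact: rsummableN.
apply: rsum_ge0 => [|i]; last by rewrite subr_ge0.
by apply: rsummableD => //; exact: rsummableN.
Qed.

Lemma ler_norm_rsum F G : rsummable G -> (forall i, `|F i| <= G i) ->
  `|rsum F| <= rsum G.
Proof.
move=> sG FG; have sF := rsummable_le FG sG.
rewrite ler_norml -rsumN//; apply/andP; split; apply: le_rsum => //.
- exact: rsummableN.
- by move=> i; have := FG i; rewrite ler_norml => /andP[].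
- by move=> i; have := FG i; rewrite ler_norml => /andP[].
Qed.

Lemma rsum_eq1 F i0 : (forall i, i != i0 -> F i = 0) ->
  rsummable F /\ rsum F = F i0.
Proof.
move=> F0.
have key (a : I -> \bar R) : (forall i, i != i0 -> a i = 0%E) -> (0 <= a i0)%E ->
    \esum_(i in [set: I]) a i = a i0.
  move=> a0 ai0; rewrite -[RHS](esum_set1)// [RHS]esum_mkcond.
  apply: eq_esum => i _; have [->|ne] := eqVneq i i0; first by rewrite mem_set.
  by rewrite memNset ?a0// => /= e; rewrite e eqxx in ne.
split.
  by rewrite /rsummable key ?ltry// => i /F0 ->; rewrite normr0.
have kp : (\esum_(i in [set: I]) (F^\+ i)%:E = (F^\+ i0)%:E)%E.
  apply: key => [i /F0|]; first by rewrite /funrpos => ->; rewrite maxxx.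
  by rewrite lee_fin le_max lexx orbT.
have kn : (\esum_(i in [set: I]) (F^\- i)%:E = (F^\- i0)%:E)%E.
  apply: key => [i /F0|]; first by rewrite /funrneg => ->; rewrite oppr0 maxxx.
  by rewrite lee_fin le_max lexx orbT.
by rewrite /rsum kp kn -EFinB /= [RHS]posneg.
Qed.

Lemma rsum_ge_term F i0 : rsummable F -> (forall i, 0 <= F i) -> F i0 <= rsum F.
Proof.
move=> sF F0; pose G i := if i == i0 then F i0 else 0.
have [sG eG] : rsummable G /\ rsum G = G i0.
  by apply: rsum_eq1 => i; rewrite /G => /negbTE ->.
have <- : rsum G = F i0 by rewrite eG /G eqxx.
by apply: le_rsum => // i; rewrite /G; case: eqP => [->|].
Qed.

End real_sums.

Lemma rsum_reindex (R : realType) (I J : choiceType) (s : I -> J) (F : J -> R) :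
  bijective s -> rsum (fun i => F (s i)) = rsum F.
Proof.
move=> [t st ts].
have sb : set_bij [set: I] [set: J] s.
  split=> [i|i j _ _ /(congr1 t)|j _] //; first by rewrite !st.
  by exists (t j).
rewrite /rsum (@reindex_esum R I J _ _ s (fun j => (F^\+ j)%:E) sb).
by rewrite (@reindex_esum R I J _ _ s (fun j => (F^\- j)%:E) sb).
Qed.

Lemma rsum_sum (R : realType) (I : choiceType) (K : Type) (s : seq K)
    (F : K -> I -> R) : (forall k, rsummable (F k)) ->
  rsummable (fun i => \sum_(k <- s) F k i) /\
  rsum (fun i => \sum_(k <- s) F k i) = \sum_(k <- s) rsum (F k).
Proof.
move=> sF; elim: s => [|k s [sS eS]].
  under eq_fun do rewrite big_nil; rewrite big_nil rsum0.
  by split=> //; exact: rsummable0.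
under eq_fun do rewrite big_cons; rewrite big_cons -eS.
by split; [exact: rsummableD|rewrite rsumD].
Qed.

(** * Complex numbers and complexified functionals *)

Section complex_numbers.
Context (R : realType).
Implicit Types (x y : R[i]) (k : R).
Local Notation Re := complex.Re.
Local Notation Im := complex.Im.

Lemma Re_mul x y : Re (x * y) = Re x * Re y - Im x * Im y.
Proof. by case: x y => [a b] [c d]. Qed.

Lemma Im_mul x y : Im (x * y) = Re x * Im y + Im x * Re y.
Proof. by case: x y => [a b] [c d]. Qed.

Lemma Re_add x y : Re (x + y) = Re x + Re y.
Proof. by case: x y => [a b] [c d]. Qed.

Lemma Im_add x y : Im (x + y) = Im x + Im y.
Proof. by case: x y => [a b] [c d]. Qed.

Lemma Re_conj x : Re (x^*) = Re x. Proof. by case: x. Qed.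
Lemma Im_conj x : Im (x^*) = - Im x. Proof. by case: x. Qed.

Lemma conj_real k : (k%:C)^* = k%:C.
Proof. exact: conjc_real. Qed.

Lemma complex_eq x y : Re x = Re y -> Im x = Im y -> x = y.
Proof. by case: x y => [a b] [c d] /= -> ->. Qed.

Lemma sqabs_ge0 x : 0 <= sqabs x.
Proof. by rewrite addr_ge0// sqr_ge0. Qed.

Lemma normcE_sqabs x : normc x = Num.sqrt (sqabs x).
Proof. by case: x. Qed.

Lemma normc_ge0 x : 0 <= normc x.
Proof. by rewrite normcE_sqabs sqrtr_ge0. Qed.

Lemma sqr_normc_sqabs x : normc x ^+ 2 = sqabs x.
Proof. by rewrite normcE_sqabs sqr_sqrtr// sqabs_ge0. Qed.

Lemma ler_Re_normc x : `|Re x| <= normc x.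
Proof.
by rewrite normcE_sqabs -sqrtr_sqr ler_sqrt ?sqabs_ge0// lerDl sqr_ge0.
Qed.

Lemma ler_Im_normc x : `|Im x| <= normc x.
Proof.
by rewrite normcE_sqabs -sqrtr_sqr ler_sqrt ?sqabs_ge0// lerDr sqr_ge0.
Qed.

Lemma ler_normc_ReIm x : normc x <= `|Re x| + `|Im x|.
Proof.
rewrite -(ler_pXn2r (n := 2))// ?nnegrE ?normc_ge0 ?addr_ge0//.
rewrite sqr_normc_sqabs /sqabs sqrrD !real_normK ?num_real//.
by rewrite -addrA lerD2l lerDr mulrn_wge0// mulr_ge0.
Qed.

Lemma normc_mul_le x y : normc x * normc y <= sqabs x + sqabs y.
Proof.
rewrite -!sqr_normc_sqabs; move: (normc x) (normc y) => a b; nra.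
Qed.

Lemma normc_conj x : normc (x^*) = normc x.
Proof. by rewrite !normcE_sqabs /sqabs Re_conj Im_conj sqrrN. Qed.

Lemma sqabsM x y : sqabs (x * y) = sqabs x * sqabs y.
Proof. by rewrite -!sqr_normc_sqabs normcM exprMn. Qed.

Lemma sqabs_real k : sqabs (k%:C) = k ^+ 2.
Proof. by rewrite /sqabs /= expr0n addr0. Qed.

Lemma sqabs_conj x : sqabs (x^*) = sqabs x.
Proof. by rewrite -!sqr_normc_sqabs normc_conj. Qed.

Lemma Re_mul_conj x : Re (x * x^*) = sqabs x.
Proof. by rewrite Re_mul Re_conj Im_conj /sqabs; ring. Qed.

Lemma Re_sum (I : Type) (s : seq I) (F : I -> R[i]) :
  Re (\sum_(i <- s) F i) = \sum_(i <- s) Re (F i).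
Proof. by elim/big_ind2 : _ => // a b x y <- <-; rewrite Re_add. Qed.

Lemma Im_sum (I : Type) (s : seq I) (F : I -> R[i]) :
  Im (\sum_(i <- s) F i) = \sum_(i <- s) Im (F i).
Proof. by elim/big_ind2 : _ => // a b x y <- <-; rewrite Im_add. Qed.

End complex_numbers.

(** Complex sums and complex integrals are both obtained from a real linear
    functional, defined on a class of good functions, by applying it to real and
    imaginary parts. This section proves complex linearity and compatibility with
    conjugation once for both. *)
Section complexification.
Context (R : realType) (X : Type).
Variables (L : (X -> R) -> R) (good : (X -> R) -> Prop).
Hypotheses
  (goodD : forall f g, good f -> good g -> good (fun x => f x + g x))
  (goodZ : forall k f, good f -> good (fun x => k * f x))
  (LD : forall f g, good f -> good g -> L (fun x => f x + g x) = L f + L g)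
  (LZ : forall k f, good f -> L (fun x => k * f x) = k * L f).
Implicit Types (F G : X -> R[i]).
Local Notation Re := complex.Re.
Local Notation Im := complex.Im.

Definition cgood F := good (fun x => Re (F x)) /\ good (fun x => Im (F x)).

Definition clin F : R[i] := L (fun x => Re (F x)) +i* L (fun x => Im (F x)).

Lemma cgoodZ (k : R[i]) F : cgood F -> cgood (fun x => k * F x).
Proof.
move=> [F1 F2]; split.
  under eq_fun do rewrite Re_mul -mulNr; apply: goodD; exact: goodZ.
by under eq_fun do rewrite Im_mul; apply: goodD; exact: goodZ.
Qed.

Lemma clinZ (k : R[i]) F : cgood F -> clin (fun x => k * F x) = k * clin F.
Proof.
move=> [F1 F2]; apply: complex_eq; rewrite ?Re_mul ?Im_mul/=.
  rewrite -mulNr -!LZ// -LD; [|exact: goodZ..].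
  by congr L; apply/funext => x; rewrite Re_mul mulNr.
rewrite -!LZ// -LD; [|exact: goodZ..].
by congr L; apply/funext => x; rewrite Im_mul.
Qed.

Lemma cgood_conj F : cgood F -> cgood (fun x => (F x)^*).
Proof.
move=> [F1 F2]; split; first by under eq_fun do rewrite Re_conj.
by under eq_fun do rewrite Im_conj -mulN1r; exact: goodZ.
Qed.

Lemma clin_conj F : cgood F -> clin (fun x => (F x)^*) = (clin F)^*.
Proof.
move=> [F1 F2]; apply: complex_eq; rewrite ?Re_conj ?Im_conj/=.
  by congr L; apply/funext => x; rewrite Re_conj.
rewrite -mulN1r -LZ//.
by congr L; apply/funext => x; rewrite Im_conj mulN1r.
Qed.

End complexification.

Section complex_sums.
Context (R : realType) (I : choiceType).
Implicit Types (F G : I -> R[i]).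

Definition csummable F := cgood (@rsummable R I) F.

Lemma csummable_le F (m : I -> R) : (forall i, normc (F i) <= m i) ->
  rsummable m -> csummable F.
Proof.
move=> Fm sm; split; apply: rsummable_le sm => i.
  exact: le_trans (ler_Re_normc _) (Fm i).
exact: le_trans (ler_Im_normc _) (Fm i).
Qed.

Lemma csummable_normc F : csummable F -> rsummable (fun i => normc (F i)).
Proof.
move=> [/rsummable_norm F1 /rsummable_norm F2].
apply: rsummable_le (rsummableD F1 F2) => i.
by rewrite ger0_norm ?normc_ge0// ler_normc_ReIm.
Qed.

Lemma csumZ k F : csummable F -> csum (fun i => k * F i) = k * csum F.
Proof. exact: (clinZ (@rsummableZ R I) (@rsumD R I) (@rsumZ R I)). Qed.

Lemma csum_conj F : csummable F -> csum (fun i => (F i)^*) = (csum F)^*.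
Proof. exact: (clin_conj (@rsumZ R I)). Qed.

Lemma eq_csum F G : F =1 G -> csum F = csum G.
Proof. by move=> /funext ->. Qed.

Lemma csum_eq1 F i0 : (forall i, i != i0 -> F i = 0) -> csum F = F i0.
Proof.
move=> F0; apply: complex_eq => /=.
  have [|_ ->//] := @rsum_eq1 R I (fun i => complex.Re (F i)) i0.
  by move=> i /F0 ->.
have [|_ ->//] := @rsum_eq1 R I (fun i => complex.Im (F i)) i0.
by move=> i /F0 ->.
Qed.

Lemma csum_sum (K : Type) (s : seq K) (F : K -> I -> R[i]) :
  (forall k, csummable (F k)) ->
  csummable (fun i => \sum_(k <- s) F k i) /\
  csum (fun i => \sum_(k <- s) F k i) = \sum_(k <- s) csum (F k).
Proof.
move=> sF.
have [s1 e1] := rsum_sum s (fun k => (sF k).1).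
have [s2 e2] := rsum_sum s (fun k => (sF k).2).
split; first by split; under eq_fun do rewrite ?Re_sum ?Im_sum.
apply: complex_eq; rewrite ?Re_sum ?Im_sum/= -?e1 -?e2.
  by apply: eq_rsum => i; rewrite Re_sum.
by apply: eq_rsum => i; rewrite Im_sum.
Qed.

End complex_sums.

(** * Exchanging sums and integrals *)

Section countable_esum.
Context (R : realType) (I : countType).

(** Enumerating a countable index type by [pickle_inv] turns unconditional sums
    into series over the natural numbers, for which integration term by term is
    available. *)
Lemma esum_nneseries (a : I -> \bar R) : (forall i, 0 <= a i)%E ->
  (\esum_(i in [set: I]) a i =
   \sum_(0 <= n <oo) (if pickle_inv n is Some i then a i else 0))%E.
Proof.
move=> a0; rewrite nneseries_esumT; last by move=> n; case: pickle_inv.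
pose b n := if pickle_inv n is Some i then a i else 0%E.
transitivity (\esum_(n in range (@pickle I)) b n).
  have sb : set_bij [set: I] (range (@pickle I)) pickle.
    by split => [i _|i j _ _ /(pcan_inj (@pickleK I))|//]; first by exists i.
  rewrite (@reindex_esum R I nat _ _ _ b sb).
  by apply: eq_esum => i _; rewrite /b pickleK_inv.
rewrite esum_mkcond; apply: eq_esum => n _; rewrite -/(b n).
case: ifPn => //; rewrite notin_setE /b => nP.
case e : pickle_inv => [i|//]; exfalso; apply: nP.
by exists i => //; have := @pickle_invK I n; rewrite e.
Qed.

Context d (T : measurableType d) (mu : {measure set T -> \bar R}) (D : set T).
Hypothesis mD : measurable D.
Variable a : I -> T -> \bar R.
Hypotheses (ma : forall i, measurable_fun D (a i))
  (a0 : forall i x, (0 <= a i x)%E).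

Let b n x := if pickle_inv n is Some i then a i x else 0%E.
Let mb n : measurable_fun D (b n).
Proof. by rewrite /b; case: pickle_inv. Qed.
Let b0 n x : (0 <= b n x)%E.
Proof. by rewrite /b; case: pickle_inv. Qed.

Lemma measurable_esum : measurable_fun D (fun x => \esum_(i in [set: I]) a i x).
Proof.
under eq_fun do rewrite esum_nneseries//.
by apply: (@ge0_emeasurable_sum _ _ _ _ b xpredT) => // n x _ _; exact: b0.
Qed.

Lemma integral_esum :
  (\int[mu]_(x in D) (\esum_(i in [set: I]) a i x) =
   \esum_(i in [set: I]) \int[mu]_(x in D) a i x)%E.
Proof.
under eq_integral do rewrite esum_nneseries//.
rewrite (@integral_nneseries _ _ _ mu D mD b)//.
rewrite esum_nneseries; last by move=> i; exact: integral_ge0.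
by apply: eq_eseriesr => n _; rewrite /b; case: pickle_inv => //; rewrite integral0.
Qed.

End countable_esum.

Section bounded_measurable.
Context d (T : measurableType d) (R : realType).
Variables (mu : {measure set T -> \bar R}) (D : set T).
Hypotheses (mD : measurable D) (muD : (mu D < +oo)%E).
Implicit Types f g : T -> R.

(** On a set of finite measure this class consists of integrable functions and,
    unlike the class of integrable functions, is stable under products. *)
Definition bmeas f :=
  measurable_fun D f /\ exists M : R, forall x, D x -> `|f x| <= M.

Lemma bmeas_integrable f : bmeas f -> mu.-integrable D (EFin \o f).
Proof.
move=> [mf [M fM]]; apply: measurable_bounded_integrable => //.
by exists M; split; [exact: num_real|move=> x Mx y Dy; exact: le_trans (fM _ Dy) (ltW Mx)].
Qed.

Lemma bmeasD f g : bmeas f -> bmeas g -> bmeas (fun x => f x + g x).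
Proof.
move=> [mf [M fM]] [mg [M' gM]]; split; first exact: measurable_funD.
exists (M + M') => x Dx; rewrite (le_trans (ler_normD _ _))// lerD//; auto.
Qed.

Lemma bmeasM f g : bmeas f -> bmeas g -> bmeas (fun x => f x * g x).
Proof.
move=> [mf [M fM]] [mg [M' gM]]; split; first exact: measurable_funM.
by exists (M * M') => x Dx; rewrite normrM ler_pM//; auto.
Qed.

Lemma bmeas_cst k : bmeas (fun=> k).
Proof. by split=> //; exists `|k|. Qed.

Lemma bmeasZ k f : bmeas f -> bmeas (fun x => k * f x).
Proof. by apply: bmeasM; exact: bmeas_cst. Qed.

Lemma bmeas_sum (K : Type) (s : seq K) (f : K -> T -> R) :
  (forall k, bmeas (f k)) -> bmeas (fun x => \sum_(k <- s) f k x).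
Proof.
move=> bf; elim: s => [|k s IH].
  by under eq_fun do rewrite big_nil; exact: bmeas_cst.
by under eq_fun do rewrite big_cons; exact: bmeasD.
Qed.

Lemma Rintegral_bmeasD f g : bmeas f -> bmeas g ->
  \int[mu]_(x in D) (f x + g x) = \int[mu]_(x in D) f x + \int[mu]_(x in D) g x.
Proof. by move=> bf bg; rewrite RintegralD//; exact: bmeas_integrable. Qed.

Lemma Rintegral_bmeasZ k f : bmeas f ->
  \int[mu]_(x in D) (k * f x) = k * \int[mu]_(x in D) f x.
Proof. by move=> bf; rewrite RintegralZl//; exact: bmeas_integrable. Qed.

Lemma Rintegral_bmeas_sum (K : Type) (s : seq K) (f : K -> T -> R) :
  (forall k, bmeas (f k)) ->
  \int[mu]_(x in D) (\sum_(k <- s) f k x) = \sum_(k <- s) \int[mu]_(x in D) f k x.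
Proof.
move=> bf; elim: s => [|k s IH].
  under eq_Rintegral do rewrite big_nil; rewrite big_nil.
  by rewrite Rintegral_cst// mul0r.
under eq_Rintegral do rewrite big_cons.
by rewrite big_cons -IH Rintegral_bmeasD//; exact: bmeas_sum.
Qed.

Lemma EFin_Rintegral f : bmeas f ->
  (\int[mu]_(x in D) f x)%:E = (\int[mu]_(x in D) (f x)%:E)%E.
Proof.
by move=> bf; rewrite fineK//; apply: integrable_fin_num => //; exact: bmeas_integrable.
Qed.

Lemma normr_Rintegral_le f M : bmeas f -> (forall x, D x -> `|f x| <= M) ->
  `|\int[mu]_(x in D) f x| <= M * fine (mu D).
Proof.
move=> bf fM; apply: le_trans (le_normr_Rintegral mD (bmeas_integrable bf)) _.
rewrite -Rintegral_cst//; apply: le_Rintegral => //.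
- apply: (@bmeas_integrable (fun x => `|f x|)); case: bf => mf _; split.
    exact: measurableT_comp.
  by exists M => x Dx; rewrite normr_id; exact: fM.
- exact: (bmeas_integrable (bmeas_cst M)).
Qed.

Section series.
Context (I : countType).
Variables (F : I -> T -> R) (m : I -> R).
Hypotheses (mF : forall i, measurable_fun D (F i))
  (Fm : forall i x, D x -> `|F i x| <= m i) (sm : rsummable m).

Lemma bmeas_rsum : bmeas (fun x => rsum (F^~ x)).
Proof.
split.
  rewrite /rsum; apply: (measurableT_comp (fine_measurable measurableT)).
  apply: emeasurable_funB.
    apply: (@measurable_esum R I _ _ _ (fun i x => ((F i)^\+ x)%:E)) => [i|i x].
      by apply/measurable_EFinP; exact: measurable_funrpos.
    by rewrite lee_fin funrpos_ge0.
  apply: (@measurable_esum R I _ _ _ (fun i x => ((F i)^\- x)%:E)) => [i|i x].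
    by apply/measurable_EFinP; exact: measurable_funrneg.
  by rewrite lee_fin funrneg_ge0.
by exists (rsum m) => x Dx; apply: ler_norm_rsum => // i; exact: Fm.
Qed.

End series.

Section exchange.
Context (I : countType).

Let exchange_ge0 (F : I -> T -> R) (m : I -> R) :
  (forall i, measurable_fun D (F i)) -> (forall i x, 0 <= F i x) ->
  (forall i x, D x -> `|F i x| <= m i) -> rsummable m ->
  \int[mu]_(x in D) rsum (F^~ x) = rsum (fun i => \int[mu]_(x in D) F i x).
Proof.
move=> mF F0 Fm sm.
have bF i : bmeas (F i) by split=> //; exists (m i) => x; exact: Fm.
have sF x : D x -> rsummable (F^~ x).
  by move=> Dx; apply: rsummable_le sm => i; exact: Fm.
have sI : rsummable (fun i => \int[mu]_(x in D) F i x).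
  apply: rsummable_le (rsummableZ (fine (mu D)) sm) => i.
  by rewrite mulrC; apply: normr_Rintegral_le => // x; exact: Fm.
apply: EFin_inj; rewrite EFin_Rintegral; last exact: (bmeas_rsum mF Fm sm).
rewrite EFin_rsum//; last by move=> i; exact: Rintegral_ge0.
under eq_integral => x xD.
  rewrite EFin_rsum; [|by apply: sF; rewrite -in_setE|by []].
  over.
rewrite (@integral_esum R I _ _ mu D mD (fun i x => (F i x)%:E))//; last first.
  by move=> i; apply/measurable_EFinP.
by apply: eq_esum => i _; rewrite EFin_Rintegral.
Qed.

(** Fubini for a dominated family: since the bounds [m] are summable and the
    domain has finite measure, positive and negative parts can be treated
    separately, by monotone convergence. *)
Lemma Rintegral_rsum (F : I -> T -> R) (m : I -> R) :
  (forall i, measurable_fun D (F i)) ->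
  (forall i x, D x -> `|F i x| <= m i) -> rsummable m ->
  \int[mu]_(x in D) rsum (F^~ x) = rsum (fun i => \int[mu]_(x in D) F i x).
Proof.
move=> mF Fm sm.
pose P i := (F i)^\+; pose Q i := (F i)^\-.
have FPQ i x : F i x = P i x + -1 * Q i x.
  by rewrite mulN1r -[in LHS](funrposBneg (F i)).
have mP i : measurable_fun D (P i) by exact: measurable_funrpos.
have mQ i : measurable_fun D (Q i) by exact: measurable_funrneg.
have Pm i x : D x -> `|P i x| <= m i.
  move=> Dx; apply: le_trans (Fm i x Dx).
  by rewrite ger0_norm ?funrpos_ge0// /P /funrpos ge_max ler_norm normr_ge0.
have Qm i x : D x -> `|Q i x| <= m i.
  move=> Dx; apply: le_trans (Fm i x Dx).
  by rewrite ger0_norm ?funrneg_ge0// /Q /funrneg ge_max normr_ge0 -normrN ler_norm.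
have bP i : bmeas (P i) by split=> //; exists (m i) => x; exact: Pm.
have bQ i : bmeas (Q i) by split=> //; exists (m i) => x; exact: Qm.
have sP x : D x -> rsummable (P^~ x).
  by move=> Dx; apply: rsummable_le sm => i; exact: Pm.
have sQ x : D x -> rsummable (Q^~ x).
  by move=> Dx; apply: rsummable_le sm => i; exact: Qm.
have sI (G : I -> T -> R) : (forall i, bmeas (G i)) ->
    (forall i x, D x -> `|G i x| <= m i) ->
    rsummable (fun i => \int[mu]_(x in D) G i x).
  move=> bG Gm; apply: rsummable_le (rsummableZ (fine (mu D)) sm) => i.
  by rewrite mulrC; apply: normr_Rintegral_le => // x; exact: Gm.
transitivity (\int[mu]_(x in D) (rsum (P^~ x) + -1 * rsum (Q^~ x))).
  apply: eq_Rintegral => x /[!inE] Dx; rewrite -rsumZ ?sQ// -rsumD ?sP//.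
    by apply: eq_rsum => i; rewrite FPQ.
  by apply: rsummableZ; exact: sQ.
have bsP := bmeas_rsum mP Pm sm; have bsQ := bmeas_rsum mQ Qm sm.
rewrite Rintegral_bmeasD//; last exact: bmeasZ.
rewrite Rintegral_bmeasZ// !(exchange_ge0 _ _ _ sm)//.
- rewrite -rsumZ ?sI// -rsumD ?sI//; last by apply: rsummableZ; exact: sI.
  apply: eq_rsum => i; rewrite -Rintegral_bmeasZ// -Rintegral_bmeasD//; last exact: bmeasZ.
  by apply: eq_Rintegral => x _; rewrite FPQ.
- by move=> i x; exact: funrneg_ge0.
- by move=> i x; exact: funrpos_ge0.
Qed.

End exchange.
End bounded_measurable.

Lemma bmeasS d (T : measurableType d) (R : realType) (D : set T) (f : T -> R) :
  bmeas setT f -> bmeas D f.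
Proof.
move=> [mf [M fM]]; split; first exact: measurable_funTS.
by exists M => x _; exact: fM.
Qed.

Lemma bmeas_comp d d' (T : measurableType d) (T' : measurableType d')
    (R : realType) (g : T -> T') (f : T' -> R) :
  measurable_fun setT g -> bmeas setT f -> bmeas setT (fun x => f (g x)).
Proof.
move=> mg [mf [M fM]]; split; last by exists M => x _; exact: fM.
exact: measurableT_comp mf mg.
Qed.

(** * Series in a bounded orthonormal system *)

Section complex_integrals.
Context (R : realType) (d : nat) (D : set (d.-tuple R)).
Hypotheses (mD : measurable D) (muD : (leb R d D < +oo)%E).
Implicit Types f g : d.-tuple R -> R[i].

Definition cbmeas f := cgood (bmeas D) f.

Lemma cbmeasM f g : cbmeas f -> cbmeas g -> cbmeas (fun x => f x * g x).
Proof.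
move=> [f1 f2] [g1 g2]; split.
  under eq_fun do rewrite Re_mul -mulN1r.
  by apply: bmeasD; last apply: bmeasZ; exact: bmeasM.
by under eq_fun do rewrite Im_mul; apply: bmeasD; exact: bmeasM.
Qed.

Lemma cbmeas_conj f : cbmeas f -> cbmeas (fun x => (f x)^*).
Proof. exact: (cgood_conj (@bmeasZ _ _ R D)). Qed.

Lemma cintegralZ k f : cbmeas f ->
  cintegral D (fun x => k * f x) = k * cintegral D f.
Proof.
exact: (clinZ (@bmeasZ _ _ R D) (@Rintegral_bmeasD _ _ R (leb R d) D mD muD)
  (@Rintegral_bmeasZ _ _ R (leb R d) D mD muD)).
Qed.

Lemma cintegral_conj f : cbmeas f ->
  cintegral D (fun x => (f x)^*) = (cintegral D f)^*.
Proof. exact: (clin_conj (@Rintegral_bmeasZ _ _ R (leb R d) D mD muD)). Qed.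

Lemma eq_cintegral f g : (forall x, D x -> f x = g x) ->
  cintegral D f = cintegral D g.
Proof.
by move=> fg; apply: complex_eq; apply: eq_Rintegral => x /[!inE] Dx; rewrite fg.
Qed.

Lemma cintegral_csum (I : countType) (F : I -> d.-tuple R -> R[i]) (m : I -> R) :
  (forall i, cbmeas (F i)) -> (forall i x, D x -> normc (F i x) <= m i) ->
  rsummable m ->
  cintegral D (fun x => csum (F^~ x)) = csum (fun i => cintegral D (F i)).
Proof.
move=> bF Fm sm; apply: complex_eq => /=.
  apply: (@Rintegral_rsum _ _ R (leb R d) D mD muD I
    (fun i x => complex.Re (F i x)) m) => // [i|i x Dx].
    exact: (bF i).1.1.
  exact: le_trans (ler_Re_normc _) (Fm i x Dx).
apply: (@Rintegral_rsum _ _ R (leb R d) D mD muD I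
  (fun i x => complex.Im (F i x)) m) => // [i|i x Dx].
  exact: (bF i).2.1.
exact: le_trans (ler_Im_normc _) (Fm i x Dx).
Qed.

Lemma cbmeas_csum (I : countType) (F : I -> d.-tuple R -> R[i]) (m : I -> R) :
  (forall i, cbmeas (F i)) -> (forall i x, D x -> normc (F i x) <= m i) ->
  rsummable m -> cbmeas (fun x => csum (F^~ x)).
Proof.
move=> bF Fm sm; split; rewrite /csum /=.
  apply: (@bmeas_rsum _ _ R D I (fun i x => complex.Re (F i x)) m) => // [i|i x Dx].
    exact: (bF i).1.1.
  exact: le_trans (ler_Re_normc _) (Fm i x Dx).
apply: (@bmeas_rsum _ _ R D I (fun i x => complex.Im (F i x)) m) => // [i|i x Dx].
  exact: (bF i).2.1.
exact: le_trans (ler_Im_normc _) (Fm i x Dx).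
Qed.

End complex_integrals.

(** What the trigonometric systems of the two boxes have in common. The modulus of
    the functions is constant on the whole space and not only on [D], so that
    series converge and are bounded at every point. *)
Record bounded_orthonormal (R : realType) (d : nat) (D : set (d.-tuple R))
    (B : R) (e : 'rV[int]_d -> d.-tuple R -> R[i]) : Prop := BoundedOrthonormal {
  on_measurable : measurable D ;
  on_finite : (leb R d D < +oo)%E ;
  on_bmeas : forall h, cbmeas setT (e h) ;
  on_sqabs : forall h x, sqabs (e h x) = B ;
  on_orthonormal : forall h k, l2inner D (e h) (e k) = (h == k)%:R }.

Definition trig_series (R : realType) (d : nat)
    (e : 'rV[int]_d -> d.-tuple R -> R[i]) (c : 'rV[int]_d -> R[i])
    (x : d.-tuple R) : R[i] := csum (fun h => c h * e h x).

Section orthonormal_series.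
Context (R : realType) (d : nat) (D : set (d.-tuple R)) (B : R).
Variable e : 'rV[int]_d -> d.-tuple R -> R[i].
Hypothesis on : bounded_orthonormal D B e.
Implicit Types (c : 'rV[int]_d -> R[i]) (u v : d.-tuple R -> R[i]).
Let mD := on_measurable on.
Let muD := on_finite on.

Lemma cbmeasS u : cbmeas setT u -> cbmeas D u.
Proof.
by move=> [u1 u2]; split; exact: bmeasS.
Qed.

Lemma on_normc h x : normc (e h x) = Num.sqrt B.
Proof. by rewrite normcE_sqabs (on_sqabs on). Qed.

Lemma trig_series_summable c x : csummable c ->
  csummable (fun h => c h * e h x).
Proof.
move=> sc; apply: csummable_le (rsummableZ (Num.sqrt B) (csummable_normc sc)) => h.
by rewrite normcM on_normc mulrC.
Qed.

Lemma cbmeas_trig_series c : csummable c -> cbmeas setT (trig_series e c).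
Proof.
move=> sc; apply: (cbmeas_csum (D := setT)
    (F := fun h x => c h * e h x) _ _ (rsummableZ (Num.sqrt B) (csummable_normc sc))).
  by move=> h; apply: cgoodZ; [exact: bmeasD|exact: bmeasZ|exact: (on_bmeas on)].
by move=> h x _; rewrite normcM on_normc mulrC.
Qed.

(** Absolute summability of the coefficients dominates the series, which can
    therefore be integrated against [v] term by term; [fcoef_trig_series] and
    [parseval] are the cases where [v] is a member of the system and where it is
    another series. *)
Lemma l2inner_trig_series c u v : csummable c -> cbmeas D v ->
  (forall x, D x -> u x = trig_series e c x) ->
  l2inner D u v = csum (fun h => c h * (fcoef D e v h)^*).
Proof.
move=> sc bv uE; rewrite /l2inner.
have [M vM] : exists M, forall x, D x -> normc (v x) <= M.
  have [[_ [M1 b1]] [_ [M2 b2]]] := bv; exists (M1 + M2) => x Dx.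
  by apply: le_trans (ler_normc_ReIm _) _; apply: lerD; [exact: b1|exact: b2].
have be h : cbmeas D (e h) by apply: cbmeasS; exact: (on_bmeas on).
have bev h : cbmeas D (fun x => e h x * (v x)^*).
  by apply: cbmeasM => //; exact: cbmeas_conj.
have evM h x : D x -> normc (e h x * (v x)^*) <= Num.sqrt B * M.
  move=> Dx; rewrite normcM on_normc normc_conj.
  by apply: ler_wpM2l; [exact: sqrtr_ge0|exact: vM].
transitivity (cintegral D (fun x => csum (fun h => c h * (e h x * (v x)^*)))).
  apply: eq_cintegral => x Dx; rewrite uE// mulrC -csumZ.
    by apply: eq_csum => h; rewrite mulrCA [(v x)^* * _]mulrC.
  exact: trig_series_summable.
rewrite (cintegral_csum (m := fun h => (Num.sqrt B * M) * normc (c h)) mD muD).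
- apply: eq_csum => h; rewrite cintegralZ//; congr (_ * _).
  rewrite /fcoef /l2inner. rewrite -cintegral_conj//; last first.
    by apply: cbmeasM => //; exact: cbmeas_conj.
  by apply: eq_cintegral => x Dx; rewrite rmorphM/= conjCK mulrC.
- by move=> h; apply: cgoodZ; [exact: bmeasD|exact: bmeasZ|exact: bev].
- by move=> h x Dx; rewrite normcM mulrC; apply: ler_wpM2r; [exact: normc_ge0|exact: evM].
- by apply: rsummableZ; exact: csummable_normc.
Qed.

Lemma fcoef_trig_series c u : csummable c ->
  (forall x, D x -> u x = trig_series e c x) -> fcoef D e u =1 c.
Proof.
move=> sc uE h; rewrite /fcoef (l2inner_trig_series sc _ uE).
  have E k : c k * (fcoef D e (e h) k)^* = c k * (h == k)%:R.
    by rewrite /fcoef (on_orthonormal on) rmorph_nat.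
  rewrite (eq_csum E) (csum_eq1 (i0 := h)) ?eqxx ?mulr1//.
  by move=> k; rewrite eq_sym => /negbTE ->; rewrite mulr0.
by apply: cbmeasS; exact: (on_bmeas on).
Qed.

Lemma parseval c c' u v : csummable c -> csummable c' ->
  (forall x, D x -> u x = trig_series e c x) ->
  (forall x, D x -> v x = trig_series e c' x) ->
  l2inner D u v = csum (fun h => c h * (c' h)^*).
Proof.
move=> sc sc' uE vE.
rewrite (l2inner_trig_series sc _ uE).
  by apply: eq_csum => h; rewrite (fcoef_trig_series sc' vE).
have [[m1 [M1 b1]] [m2 [M2 b2]]] := cbmeasS (cbmeas_trig_series sc').
split; split.
- by apply: eq_measurable_fun m1 => x /[!inE] Dx; rewrite vE.
- by exists M1 => x Dx; rewrite vE//; exact: b1.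
- by apply: eq_measurable_fun m2 => x /[!inE] Dx; rewrite vE.
- by exists M2 => x Dx; rewrite vE//; exact: b2.
Qed.

Variable r : 'rV[int]_d -> R.
Hypotheses (r_gt0 : forall h, 0 < r h)
  (r_sum : rsummable (fun h => r h ^- 2)).

Definition wsummable c := rsummable (fun h => sqabs (c h) * r h ^+ 2).

(** The elementary inequality [2 s <= s^2 r^2 + r^-2] replaces Cauchy-Schwarz:
    a function of finite norm has an absolutely summable series because
    [r^-2] is summable. *)
Lemma wsummable_csummable c : wsummable c -> csummable c.
Proof.
move=> sc; apply: csummable_le (rsummableD sc r_sum) => h.
have rh := r_gt0 h.
rewrite -sqr_normc_sqabs -exprMn -exprVn; set p := normc (c h) * r h.
have -> : normc (c h) = p * (r h)^-1 by rewrite /p mulfK// gt_eqF.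
have: 0 <= (p - (r h)^-1) ^+ 2 by exact: sqr_ge0.
have: 0 <= (p + (r h)^-1) ^+ 2 by exact: sqr_ge0.
move: ((r h)^-1) => q; nra.
Qed.

Lemma wsummable_sqabs c : wsummable c -> rsummable (fun h => sqabs (c h)).
Proof.
move=> sc; apply: rsummable_le (rsummableZ (rsum (fun h => r h ^- 2)) sc) => h.
rewrite ger0_norm ?sqabs_ge0// mulrCA ler_peMr ?sqabs_ge0//.
rewrite -ler_pdivrMr ?exprn_gt0// mul1r.
by apply: (rsum_ge_term (F := fun h => r h ^- 2)) => // k; rewrite invr_ge0 exprn_ge0// ltW.
Qed.

(** The Fourier coefficients of the kernel section at [x], see [kkernelE]. *)
Definition kernel_coef (x : d.-tuple R) h : R[i] := (r h ^- 2)%:C * (e h x)^*.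

Lemma sqabs_kernel_coef x h : sqabs (kernel_coef x h) * r h ^+ 2 = B * r h ^- 2.
Proof.
rewrite sqabsM sqabs_real sqabs_conj (on_sqabs on).
by field; rewrite gt_eqF.
Qed.

Lemma wsummable_kernel x : wsummable (kernel_coef x).
Proof.
by rewrite /wsummable; under eq_fun do rewrite sqabs_kernel_coef; exact: rsummableZ.
Qed.

Lemma kkernelE y x : kkernel e r y x = trig_series e (kernel_coef x) y.
Proof. by apply: eq_csum => h; rewrite mulrAC. Qed.

(** For a function of the space, the reproducing formula is the pointwise
    convergence of its Fourier series: the weights [r^2] of the inner product
    cancel the factors [r^-2] of the coefficients of the kernel. *)
Lemma in_rkhs_coef u : in_rkhs D e r u ->
  wsummable (fcoef D e u) /\
  forall x, D x -> u x = trig_series e (fcoef D e u) x.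
Proof.
move=> [un uK]; split.
  by apply: rsummable_ge0 un => h; rewrite mulr_ge0 ?sqabs_ge0 ?sqr_ge0.
move=> x Dx; rewrite uK//; apply: eq_csum => h.
have -> := fcoef_trig_series (wsummable_csummable (wsummable_kernel x))
  (fun y _ => kkernelE y x).
rewrite /kernel_coef rmorphM/= conjCK conj_real -mulrA mulrAC -!mulrA.
rewrite [X in _ * X = _]mulrA -rmorphM/= mulVf ?expf_eq0 ?gt_eqF//.
by rewrite mul1r.
Qed.

Section synthesis.
Variables (c : 'rV[int]_d -> R[i]) (u : d.-tuple R -> R[i]).
Hypotheses (sc : wsummable c) (uE : forall x, D x -> u x = trig_series e c x).

Lemma fcoefE : fcoef D e u = c.
Proof. by apply/funext/(fcoef_trig_series (wsummable_csummable sc) uE). Qed.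

Lemma kinner_kernel x :
  kinner D e r u (fun y => kkernel e r y x) = trig_series e c x.
Proof.
apply: eq_csum => h; rewrite fcoefE.
have -> := fcoef_trig_series (wsummable_csummable (wsummable_kernel x))
  (fun y _ => kkernelE y x).
rewrite /kernel_coef rmorphM/= conjCK conj_real -mulrA mulrAC -!mulrA.
rewrite [X in _ * X = _]mulrA -rmorphM/= mulVf ?expf_eq0 ?gt_eqF//.
by rewrite mul1r.
Qed.

Lemma ksqnormE : ksqnorm D e r u = (rsum (fun h => sqabs (c h) * r h ^+ 2))%:E.
Proof.
rewrite EFin_rsum//; last by move=> h; rewrite mulr_ge0 ?sqabs_ge0 ?sqr_ge0.
by rewrite /ksqnorm fcoefE.
Qed.

Lemma sqr_knorm : knorm D e r u ^+ 2 = rsum (fun h => sqabs (c h) * r h ^+ 2).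
Proof.
rewrite /knorm ksqnormE sqr_sqrtr//.
by apply: rsum_ge0 => // h; rewrite mulr_ge0 ?sqabs_ge0 ?sqr_ge0.
Qed.

Lemma in_rkhs_series : in_rkhs D e r u.
Proof.
split; first by rewrite ksqnormE ltry.
by move=> x Dx; rewrite kinner_kernel uE.
Qed.

End synthesis.

End orthonormal_series.

(** * Semi-inner products and regularized least squares *)

Section semi_inner_product.
Context (R : realType) (E : lmodType R).

Record semi_inner (q : E -> E -> R) : Prop := SemiInner {
  siC : forall x y, q x y = q y x ;
  siDl : forall x y z, q (x + y) z = q x z + q y z ;
  siZl : forall k x y, q (k *: x) y = k * q x y ;
  si_ge0 : forall x, 0 <= q x x }.

Section theory.
Variable q : E -> E -> R.
Hypothesis si : semi_inner q.
Implicit Types (x y z : E) (k : R).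

Lemma siDr x y z : q x (y + z) = q x y + q x z.
Proof. by rewrite (siC si) (siDl si) !(siC si x). Qed.

Lemma siZr k x y : q x (k *: y) = k * q x y.
Proof. by rewrite (siC si) (siZl si) (siC si x). Qed.

Lemma si0l y : q 0 y = 0.
Proof. by rewrite -(scale0r 0) (siZl si) mul0r. Qed.

Lemma siBl x y z : q (x - y) z = q x z - q y z.
Proof. by rewrite (siDl si) -scaleN1r (siZl si) mulN1r. Qed.

Lemma siBr x y z : q x (y - z) = q x y - q x z.
Proof. by rewrite !(siC si x) siBl. Qed.

Lemma si_suml n (v : 'I_n -> E) (k : 'I_n -> R) y :
  q (\sum_i k i *: v i) y = \sum_i k i * q (v i) y.
Proof.
elim/big_ind2 : _ => [|a b x z <- <-|i _]; [exact: si0l|exact: (siDl si)|].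
exact: (siZl si).
Qed.

(** Otherwise the quadratic form would be negative somewhere on a line of
    direction [x] through [y]. *)
Lemma si_null x y : q x x = 0 -> q x y = 0.
Proof.
move=> x0; apply/eqP/negPn/negP => xy0.
(* the parameter for which the form takes the value -1 *)
pose t := - (q y y + 1) / (2 * q x y).
have := si_ge0 si (t *: x + y).
rewrite (siDl si) !siDr !(siZl si) !siZr x0 (siC si y x) !mulr0 add0r.
have -> : t * q x y = - (q y y + 1) / 2 by rewrite /t; field.
by move: (q y y) => b; lra.
Qed.

Definition orthonormal m (e : 'I_m -> E) := forall i j, q (e i) (e j) = (i == j)%:R.

Definition residual m (e : 'I_m -> E) x := x - \sum_i q x (e i) *: e i.

Lemma si_orthonormal_suml m (e : 'I_m -> E) (k : 'I_m -> R) j :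
  orthonormal e -> q (\sum_i k i *: e i) (e j) = k j.
Proof.
move=> one; rewrite si_suml (bigD1 j)//= one eqxx mulr1 big1 ?addr0//.
by move=> i ij; rewrite one (negbTE ij) mulr0.
Qed.

Lemma residual_orthogonal m (e : 'I_m -> E) x j :
  orthonormal e -> q (residual e x) (e j) = 0.
Proof. by move=> one; rewrite siBl si_orthonormal_suml// subrr. Qed.

(** The form may be degenerate, so the orthonormal family spans the given vectors
    only up to vectors that are orthogonal to everything; a vector whose residual
    has norm zero is simply skipped. *)
Lemma gram_schmidt (s : seq E) : exists m (e : 'I_m -> E), orthonormal e /\
  forall x, x \in s -> forall y, q (residual e x) y = 0.
Proof.
elim: s => [|x s [m [e [one se]]]].
  by exists 0%N, (fun=> 0); split => [[]|//].
pose r := residual e x.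
have [r0|rn0] := eqVneq (q r r) 0.
  exists m, e; split => // z; rewrite inE => /orP[/eqP ->|/se//] y.
  exact: si_null.
pose n := Num.sqrt (q r r).
have r_gt0 : 0 < q r r by rewrite lt_def rn0 (si_ge0 si).
have n_gt0 : 0 < n by rewrite sqrtr_gt0.
have nn : n * n = q r r by rewrite -expr2 sqr_sqrtr// ltW.
pose e0 := n^-1 *: r.
have e0e j : q e0 (e j) = 0 by rewrite (siZl si) residual_orthogonal// mulr0.
pose e' (i : 'I_m.+1) := if unlift ord0 i is Some j then e j else e0.
have e'0 : e' ord0 = e0 by rewrite /e' unlift_none.
have e'S j : e' (lift ord0 j) = e j by rewrite /e' liftK.
exists m.+1, e'; split.
  move=> i j; case: (unliftP ord0 i) => [i' ->|->]; case: (unliftP ord0 j) => [j' ->|->].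
  - by rewrite !e'S one (inj_eq lift_inj).
  - by rewrite e'S e'0 (siC si) e0e.
  - by rewrite e'S e'0 e0e.
  - by rewrite e'0 eqxx (siZl si) siZr -nn mulKf ?mulVf ?gt_eqF.
have res z : residual e' z = residual e z - q z e0 *: e0.
  rewrite /residual big_ord_recl e'0 opprD addrCA addrC; congr (_ - _ - _).
  by apply: eq_bigr => i _; rewrite e'S.
have qe0 z : q z e0 = q (residual e z) e0.
  rewrite siBl si_suml big1 ?subr0// => i _.
  by rewrite [q (e i) _](siC si) e0e mulr0.
move=> z; rewrite inE => /orP[/eqP -> | /se zs] y.
  rewrite res qe0 -/r siZr -/r -nn mulrA mulVf ?gt_eqF// mul1r scalerA divff ?gt_eqF//.
  by rewrite scale1r subrr si0l.
by rewrite res qe0 zs scale0r subr0.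
Qed.

End theory.
End semi_inner_product.

Section finite_dimension.
Context (R : realType) (n : nat) (q : 'rV[R]_n -> 'rV[R]_n -> R).
Hypothesis si : semi_inner q.
Implicit Types (x y : 'rV[R]_n).

Lemma orthonormal_basis : exists m (e : 'I_m -> 'rV[R]_n), orthonormal q e /\
  forall x y, q (residual q e x) y = 0.
Proof.
have [m [e [one se]]] := gram_schmidt si [seq delta_mx 0 i | i : 'I_n].
exists m, e; split=> // x y.
have resD u v : residual q e (u + v) = residual q e u + residual q e v.
  rewrite /residual addrACA -opprD -big_split/=; congr (_ - _).
  by apply: eq_bigr => i _; rewrite (siDl si) scalerDl.
have resZ k u : residual q e (k *: u) = k *: residual q e u.
  rewrite /residual scalerBr scaler_sumr; congr (_ - _).
  by apply: eq_bigr => i _; rewrite (siZl si) scalerA.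
rewrite (row_sum_delta x).
elim/big_ind : _ => [|u v u0 v0|i _].
- by rewrite -(scale0r 0) resZ scale0r (si0l si).
- by rewrite resD (siDl si) u0 v0 addr0.
- by rewrite resZ (siZl si) se ?mulr0//; apply/mapP; exists i; rewrite ?mem_enum.
Qed.

(** The nonnegativity of [F - 2 l x + q x x] makes [l] continuous for [q]. It is
    how linear forms arise here: as inner products with a fixed vector, of squared
    norm [F], that need not lie in the finite-dimensional space. *)
Section linear_form.
Variables (l : 'rV[R]_n -> R) (F : R).
Hypotheses (lD : forall x y, l (x + y) = l x + l y)
  (lZ : forall k x, l (k *: x) = k * l x)
  (lF : forall x, 0 <= F - 2 * l x + q x x).

Lemma linear_form_null x : q x x = 0 -> l x = 0.
Proof.
move=> x0; apply/eqP/negPn/negP => lx0.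
have := lF (((F + 1) / (2 * l x)) *: x).
rewrite lZ (siZl si) (siZr si) x0 !mulr0 addr0.
have -> : (F + 1) / (2 * l x) * l x = (F + 1) / 2 by field.
by lra.
Qed.

Lemma linear_form_sum m (e : 'I_m -> 'rV[R]_n) (k : 'I_m -> R) :
  l (\sum_i k i *: e i) = \sum_i k i * l (e i).
Proof.
elim/big_ind2 : _ => [|a b x z <- <-|i _]; [|exact: lD|exact: lZ].
by rewrite -(scale0r 0) lZ mul0r.
Qed.

Lemma riesz m (e : 'I_m -> 'rV[R]_n) : orthonormal q e ->
  (forall x y, q (residual q e x) y = 0) ->
  forall y, q (\sum_i l (e i) *: e i) y = l y.
Proof.
move=> one res y; pose s := \sum_i q y (e i) *: e i.
have ys : y = residual q e y + s by rewrite subrK.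
have -> : l y = l s.
  by rewrite {1}ys lD linear_form_null ?add0r//; exact: res.
rewrite {1}ys (siDr si) (siC si) res add0r /s linear_form_sum (siC si) (si_suml si).
by apply: eq_bigr => i _; rewrite [q (e i) _](siC si) (si_orthonormal_suml si).
Qed.

End linear_form.
End finite_dimension.

(** In this section [l] is the inner product of [L] with an external target of
    squared norm [F], so that [sqdist x] is the squared distance from [x] to the
    target, and [mean_fit] minimizes [sqdist x + lambda * K x x]. *)
Section regularized_least_squares.
Context (R : realType) (n : nat) (L K : 'rV[R]_n -> 'rV[R]_n -> R) (lambda : R).
Hypotheses (siL : semi_inner L) (siK : semi_inner K) (lambda_gt0 : 0 < lambda).
Variables (l : 'rV[R]_n -> R) (F : R).
Hypotheses (lD : forall x y, l (x + y) = l x + l y)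
  (lZ : forall k x, l (k *: x) = k * l x)
  (lF : forall x, 0 <= F - 2 * l x + L x x).
Implicit Types (x y p : 'rV[R]_n).

Definition reg_form x y := L x y + lambda * K x y.

Definition sqdist x := F - 2 * l x + L x x.

Lemma semi_inner_reg : semi_inner reg_form.
Proof.
split=> [x y|x y z|k x y|x]; rewrite /reg_form.
- by rewrite (siC siL) (siC siK).
- by rewrite (siDl siL) (siDl siK); ring.
- by rewrite (siZl siL) (siZl siK); ring.
- by rewrite addr_ge0 ?(si_ge0 siL)// mulr_ge0 ?(si_ge0 siK)// ltW.
Qed.

Let siB := semi_inner_reg.

Let lFB x : 0 <= F - 2 * l x + reg_form x x.
Proof.
rewrite /reg_form addrA; apply: addr_ge0; first exact: lF.
by rewrite mulr_ge0 ?(si_ge0 siK)// ltW.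
Qed.

Variables (m : nat) (e : 'I_m -> 'rV[R]_n).
Hypotheses (one : orthonormal reg_form e)
  (res : forall x y, reg_form (residual reg_form e x) y = 0).

Definition mean_fit := \sum_i l (e i) *: e i.

Lemma mean_fitE y : reg_form mean_fit y = l y.
Proof. exact: riesz. Qed.

(** Completing the square: the functional is, up to a constant, the squared
    [reg_form]-distance to [mean_fit]. *)
Lemma mean_fit_min p :
  sqdist mean_fit + lambda * K mean_fit mean_fit <= sqdist p + lambda * K p p.
Proof.
have E x : sqdist x + lambda * K x x =
    F - 2 * reg_form mean_fit x + reg_form x x.
  by rewrite mean_fitE /sqdist /reg_form; ring.
have := si_ge0 siB (p - mean_fit).
rewrite (siBl siB) !(siBr siB) (siC siB p mean_fit) !E; lra.
Qed.

(** Bias-variance decomposition. The quadratic term is bounded in the larger form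
    [reg_form], where the basis is orthonormal; the cross term is kept because it
    is linear in the deviations and has zero mean when they have. *)
Lemma sqdist_fit_le (eta : 'I_m -> R) :
  sqdist (\sum_i eta i *: e i) <=
  \sum_i (eta i - l (e i)) ^+ 2
  + 2 * (\sum_i (eta i - l (e i)) * (L (e i) mean_fit - l (e i)))
  + sqdist mean_fit.
Proof.
set x := \sum_i _; pose w := \sum_i (eta i - l (e i)) *: e i.
have xw : x = w + mean_fit.
  rewrite /x /w /mean_fit -big_split/=; apply: eq_bigr => i _.
  by rewrite -scalerDl subrK.
have Bw : reg_form w w = \sum_i (eta i - l (e i)) ^+ 2.
  rewrite (si_suml siB); apply: eq_bigr => i _.
  by rewrite [reg_form (e i) _](siC siB) (si_orthonormal_suml siB).
have Lw : L w w <= \sum_i (eta i - l (e i)) ^+ 2.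
  by rewrite -Bw lerDl mulr_ge0 ?(si_ge0 siK)// ltW.
have -> : \sum_i (eta i - l (e i)) * (L (e i) mean_fit - l (e i)) =
    L w mean_fit - l w.
  rewrite (si_suml siL) (linear_form_sum lD lZ) -sumrB.
  by apply: eq_bigr => i _; rewrite mulrBr.
rewrite /sqdist xw (siDl siL) !(siDr siL) lD (siC siL mean_fit w).
by move: Lw; lra.
Qed.

(** A solution of the variational equation is known only up to a null vector of
    [reg_form], which does not change the distance to the target; its coordinates
    in the basis are the values of the right-hand side on the basis. *)
Lemma sqdist_galerkin x (ev : 'rV[R]_n -> R) :
  (forall y, reg_form x y = ev y) ->
  sqdist x = sqdist (\sum_i ev (e i) *: e i).
Proof.
move=> xev; set s := \sum_i _; pose r := residual reg_form e x.
have xs : x = r + s.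
  rewrite /r /residual (_ : \sum_i _ = s) ?subrK//.
  by apply: eq_bigr => i _; rewrite xev.
have lr : l r = 0 by apply: (linear_form_null siB lZ lFB); exact: res.
have Lr : L r r = 0.
  have := res x r; rewrite -/r /reg_form => /eqP.
  rewrite paddr_eq0 ?(si_ge0 siL) ?mulr_ge0 ?(si_ge0 siK) ?ltW//.
  by case/andP => /eqP.
rewrite /sqdist xs; clearbody r s.
rewrite lD (siDl siL) !(siDr siL) (siC siL s r) lr Lr.
by rewrite !(si_null siL _ Lr) !add0r.
Qed.

End regularized_least_squares.

(** * Weighted inner products of coefficient families *)

(** Real parts of the inner products are taken throughout because the estimator
    ranges over a real span. With the weight [w] equal to [1], to [r^2] and to
    [1 + lambda r^2], [wform w] is the inner product of L^2, of the Korobov space,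
    and their regularized combination. *)
Section weighted_forms.
Context (R : realType) (I : choiceType) (w : I -> R).
Hypothesis w_ge0 : forall h, 0 <= w h.
Implicit Types (c : I -> R[i]) (k : R).

Definition in_weighted_l2 c := rsummable (fun h => sqabs (c h) * w h).

Definition wform c c' := rsum (fun h => complex.Re (c h * (c' h)^*) * w h).

Lemma sqabsD_le (x y : R[i]) : sqabs (x + y) <= 2 * (sqabs x + sqabs y).
Proof.
rewrite /sqabs Re_add Im_add; move: (complex.Re x) (complex.Im x)
  (complex.Re y) (complex.Im y) => a b a' b'.
have := sqr_ge0 (a - a'); have := sqr_ge0 (b - b'); nra.
Qed.

Lemma in_weighted_l2D c c' : in_weighted_l2 c -> in_weighted_l2 c' ->
  in_weighted_l2 (fun h => c h + c' h).
Proof.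
move=> sc sc'; apply: rsummable_le (rsummableZ 2 (rsummableD sc sc')) => h.
rewrite ger0_norm ?mulr_ge0 ?sqabs_ge0// -mulrDl mulrA ler_wpM2r//.
exact: sqabsD_le.
Qed.

Lemma in_weighted_l2Z (k : R[i]) c : in_weighted_l2 c ->
  in_weighted_l2 (fun h => k * c h).
Proof.
move=> /(rsummableZ (sqabs k)); rewrite /in_weighted_l2.
by under eq_fun do rewrite mulrA -sqabsM.
Qed.

Lemma in_weighted_l2_sum (K : Type) (s : seq K) (c : K -> I -> R[i]) :
  (forall j, in_weighted_l2 (c j)) ->
  in_weighted_l2 (fun h => \sum_(j <- s) c j h).
Proof.
move=> sc; elim: s => [|j s IH].
  rewrite /in_weighted_l2; under eq_fun do rewrite big_nil /sqabs/= expr0n addr0 mul0r.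
  exact: rsummable0.
by rewrite /in_weighted_l2; under eq_fun do rewrite big_cons; exact: in_weighted_l2D.
Qed.

Lemma wform_summable c c' : in_weighted_l2 c -> in_weighted_l2 c' ->
  rsummable (fun h => complex.Re (c h * (c' h)^*) * w h).
Proof.
move=> sc sc'; apply: rsummable_le (rsummableD sc sc') => h.
rewrite normrM (ger0_norm (w_ge0 h)) -mulrDl ler_wpM2r//.
apply: le_trans (ler_Re_normc _) _.
by rewrite normcM normc_conj normc_mul_le.
Qed.

Lemma wformC c c' : wform c c' = wform c' c.
Proof.
by apply: eq_rsum => h; rewrite !Re_mul !Re_conj !Im_conj; ring.
Qed.

Lemma wformDl c c1 c2 : in_weighted_l2 c -> in_weighted_l2 c1 -> in_weighted_l2 c2 ->
  wform (fun h => c1 h + c2 h) c = wform c1 c + wform c2 c.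
Proof.
move=> sc s1 s2; rewrite /wform -rsumD; [|exact: wform_summable..].
by apply: eq_rsum => h; rewrite mulrDl Re_add mulrDl.
Qed.

Lemma wformZl k c c1 : in_weighted_l2 c -> in_weighted_l2 c1 ->
  wform (fun h => k%:C * c1 h) c = k * wform c1 c.
Proof.
move=> sc s1; rewrite /wform -rsumZ; last exact: wform_summable.
by apply: eq_rsum => h; rewrite -mulrA Re_mul /= mul0r subr0 mulrA.
Qed.

Lemma wform_sqabs c : wform c c = rsum (fun h => sqabs (c h) * w h).
Proof. by apply: eq_rsum => h; rewrite Re_mul_conj. Qed.

Lemma wform_ge0 c : in_weighted_l2 c -> 0 <= wform c c.
Proof.
by move=> sc; rewrite wform_sqabs rsum_ge0// => h; rewrite mulr_ge0 ?sqabs_ge0.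
Qed.

(** Real linear combinations of finitely many families, parametrized by their
    coordinates: pulling [wform] back to coordinates gives semi-inner products on
    a finite-dimensional space, to which the previous part applies. *)
Section combinations.
Variables (n : nat) (C : 'I_n -> I -> R[i]).
Hypothesis sC : forall j, in_weighted_l2 (C j).
Implicit Types (t : 'rV[R]_n).

Definition comb t h : R[i] := \sum_(j < n) (t 0 j)%:C * C j h.

Lemma in_weighted_l2_comb t : in_weighted_l2 (comb t).
Proof. by apply: in_weighted_l2_sum => j; exact: in_weighted_l2Z. Qed.

Lemma combD t t' : comb (t + t') = fun h => comb t h + comb t' h.
Proof.
apply/funext => h; rewrite /comb -big_split/=; apply: eq_bigr => k _.
by rewrite mxE rmorphD mulrDl.
Qed.

Lemma combZ k t : comb (k *: t) = fun h => k%:C * comb t h.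
Proof.
apply/funext => h; rewrite /comb mulr_sumr; apply: eq_bigr => j _.
by rewrite mxE rmorphM mulrA.
Qed.

Lemma semi_inner_wform : semi_inner (fun t t' => wform (comb t) (comb t')).
Proof.
split=> [t t'|t1 t2 t|k t t'|t].
- exact: wformC.
- by rewrite combD wformDl//; exact: in_weighted_l2_comb.
- by rewrite combZ wformZl//; exact: in_weighted_l2_comb.
- by apply: wform_ge0; exact: in_weighted_l2_comb.
Qed.

Variable f : I -> R[i].
Hypothesis sf : in_weighted_l2 f.

Lemma wform_combDr t t' : wform f (comb (t + t')) = wform f (comb t) + wform f (comb t').
Proof.
by rewrite combD wformC wformDl ?(wformC f)//; exact: in_weighted_l2_comb.
Qed.

Lemma wform_combZr k t : wform f (comb (k *: t)) = k * wform f (comb t).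
Proof. by rewrite combZ wformC wformZl ?(wformC f)//; exact: in_weighted_l2_comb. Qed.

Lemma wform_sub_comb t :
  wform (fun h => f h + -1 * comb t h) (fun h => f h + -1 * comb t h) =
  wform f f - 2 * wform f (comb t) + wform (comb t) (comb t).
Proof.
have sc := in_weighted_l2_comb t.
have e : (fun h => f h + -1 * comb t h) = (fun h => f h + (-1)%:C * comb t h).
  by apply/funext => h; rewrite rmorphN1.
have sN : in_weighted_l2 (fun h => (-1)%:C * comb t h) by exact: in_weighted_l2Z.
have sD : in_weighted_l2 (fun h => f h + (-1)%:C * comb t h) by exact: in_weighted_l2D.
rewrite e wformDl// wformZl// (wformC f) (wformC (comb t)).
by rewrite !wformDl// !wformZl// (wformC (comb t) f); ring.
Qed.

Lemma in_weighted_l2_sub t : in_weighted_l2 (fun h => f h + -1 * comb t h).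
Proof.
by apply: in_weighted_l2D => //; apply: in_weighted_l2Z; exact: in_weighted_l2_comb.
Qed.

End combinations.
End weighted_forms.

(** * Integrals of tensor products *)

Section product_integral.
Context d1 d2 (T1 : measurableType d1) (T2 : measurableType d2) (R : realType).
Variables (m1 : {sigma_finite_measure set T1 -> \bar R})
  (m2 : {sigma_finite_measure set T2 -> \bar R}) (D1 : set T1) (D2 : set T2).
Hypotheses (mD1 : measurable D1) (mD2 : measurable D2)
  (fD1 : (m1 D1 < +oo)%E) (fD2 : (m2 D2 < +oo)%E).

Lemma bmeas_patch d (T : measurableType d) (D : set T) (p : T -> R) :
  measurable D -> bmeas D p -> bmeas setT (p \_ D).
Proof.
move=> mD [mp [M pM]]; split; first by apply/(measurable_restrictT _ mD).
exists `|M| => x _; rewrite patchE; case: ifPn => [/[!inE] Dx|_].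
  exact: le_trans (pM x Dx) (ler_norm _).
by rewrite normr0.
Qed.

Lemma Rintegral_prod (p : T1 -> R) (q : T2 -> R) : bmeas D1 p -> bmeas D2 q ->
  \int[(m1 \x m2)%E]_(z in D1 `*` D2) (p z.1 * q z.2) =
  (\int[m1]_(x in D1) p x) * (\int[m2]_(y in D2) q y).
Proof.
move=> bp bq.
pose p' := p \_ D1; pose q' := q \_ D2.
have bp' := bmeas_patch mD1 bp; have bq' := bmeas_patch mD2 bq.
have FE : (fun z : T1 * T2 => p z.1 * q z.2) \_ (D1 `*` D2) =
    (fun z => p' z.1 * q' z.2).
  apply/funext => -[x y]; rewrite /p' /q' !patchE in_setX/=.
  by case: (x \in D1); case: (y \in D2); rewrite ?mulr0 ?mul0r.
have mD12 : measurable (D1 `*` D2) by exact: measurableX.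
have mF : measurable_fun setT (fun z : T1 * T2 => p' z.1 * q' z.2).
  apply: measurable_funM.
    exact: (measurableT_comp bp'.1 measurable_fst).
  exact: (measurableT_comp bq'.1 measurable_snd).
have intF : (m1 \x m2)%E.-integrable setT (EFin \o (fun z => p' z.1 * q' z.2)).
  rewrite -FE -restrict_EFin; apply/(integrable_mkcond _ mD12).
  apply: measurable_bounded_integrable => //.
  - by rewrite /= product_measure1E// lte_mul_pinfty// ge0_fin_numE.
  - have mF' : measurable_fun (D1 `*` D2) (fun z : T1 * T2 => p' z.1 * q' z.2).
      exact: measurable_funTS.
    apply: eq_measurable_fun mF' => -[x y] /[!inE] -[/= Dx Dy].
    by rewrite /p' /q' !patchE !mem_set.
  have [_ [M1 M1p]] := bp; have [_ [M2 M2q]] := bq.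
  exists (M1 * M2); split; first exact: num_real.
  move=> M ltM [x y] [/= Dx Dy]; apply: le_trans (ltW ltM).
  by rewrite normrM ler_pM//; auto.
rewrite Rintegral_mkcond FE {1}/Rintegral -integral12_prod_meas1//.
have ip : m1.-integrable setT (EFin \o p').
  rewrite /p' -restrict_EFin; apply/(integrable_mkcond _ mD1).
  exact: bmeas_integrable.
have iq : m2.-integrable setT (EFin \o q').
  rewrite /q' -restrict_EFin; apply/(integrable_mkcond _ mD2).
  exact: bmeas_integrable.
rewrite [in RHS]Rintegral_mkcond [X in _ = _ * X]Rintegral_mkcond.
rewrite -/p' -/q'; rewrite -RintegralZr//; congr fine.
apply: eq_integral => x _; rewrite /fubini_F/=.
under eq_integral do rewrite EFinM.
rewrite integralZl// EFinM; congr (_ * _)%E.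
by rewrite fineK//; exact: integrable_fin_num.
Qed.

End product_integral.

Section tuple_integral.
Context (R : realType) (D1 : set R).
Hypotheses (mD1 : measurable (D1 : set (measurableTypeR R)))
  (fD1 : (@lebesgue_measure R D1 < +oo)%E).

Definition cube n : set (n.-tuple R) := [set x | forall j, D1 (tnth x j)].

Lemma measurable_cube n : measurable (@cube n).
Proof.
rewrite (_ : @cube n = \bigcap_(i in [set: 'I_n])
    ((fun x : n.-tuple R => tnth x i) @^-1` D1)).
  apply: fin_bigcap_measurable => // i _.
  by rewrite -[X in measurable X]setTI; exact: measurable_tnth.
by apply/seteqP; split=> x /= Ax => [i _|i]; exact: Ax.
Qed.

Lemma leb_cube n : leb R n (@cube n) = ((fine (lebesgue_measure D1)) ^+ n)%:E.
Proof.
rewrite (@leb_rect R n (fun=> D1))// big_const card_ord.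
elim: n => [//|n IH]; rewrite iterS IH exprS EFinM fineK//.
by rewrite ge0_fin_numE.
Qed.

Lemma leb_cube_fin n : (leb R n (@cube n) < +oo)%E.
Proof. by rewrite leb_cube ltry. Qed.

Lemma tcons_preimage_cube n :
  @tcons R n @^-1` (@cube n.+1) = D1 `*` @cube n.
Proof.
apply/seteqP; split => -[x t] /=.
  move=> At; split; first exact: (At ord0).
  by move=> i; have := At (lift ord0 i); rewrite tnthS.
move=> [Ax At] i; case: (unliftP ord0 i) => [j ->|->]; last exact: Ax.
by rewrite tnthS; exact: At.
Qed.

Lemma Rintegral_tcons n (f : n.+1.-tuple R -> R) : bmeas setT f ->
  \int[leb R n.+1]_(x in @cube n.+1) f x =
  \int[(lebesgue_measure \x leb R n)%E]_(z in D1 `*` @cube n) f (tcons z).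
Proof.
move=> bf; rewrite /Rintegral; congr fine.
rewrite -tcons_preimage_cube.
apply: (@integral_pushforward _ _ _ _ R _ (@measurable_tcons R n)
  (lebesgue_measure \x leb R n)%E (@cube n.+1) (EFin \o f)).
- by apply/measurable_EFinP; exact: bf.1.
- rewrite tcons_preimage_cube.
  have bft := bmeas_comp (@measurable_tcons R n) bf.
  apply: (@bmeas_integrable _ _ _ _ _ _ _ (f \o @tcons R n)).
  + by apply: measurableX => //; exact: measurable_cube.
  + rewrite /= product_measure1E//; last exact: measurable_cube.
    by rewrite lte_mul_pinfty// ?ge0_fin_numE// leb_cube_fin.
  + exact: bmeasS bft.
- exact: measurable_cube.
Qed.

Lemma bmeas_thead n (p : R -> R) : bmeas (setT : set (measurableTypeR R)) p ->
  bmeas setT (fun x : n.+1.-tuple R => p (thead x)).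
Proof. by apply: bmeas_comp; exact: measurable_tnth. Qed.

Lemma bmeas_behead n (q : n.-tuple R -> R) : bmeas setT q ->
  bmeas setT (fun x : n.+1.-tuple R => q [tuple of behead x]).
Proof. by apply: bmeas_comp; exact: measurable_behead. Qed.

Lemma Rintegral_tensor n (p : R -> R) (q : n.-tuple R -> R) :
  bmeas (setT : set (measurableTypeR R)) p -> bmeas setT q ->
  \int[leb R n.+1]_(x in @cube n.+1) (p (thead x) * q [tuple of behead x]) =
  (\int[lebesgue_measure]_(x in D1) p x) * (\int[leb R n]_(x in @cube n) q x).
Proof.
move=> bp bq.
rewrite (@Rintegral_tcons n (fun x => p (thead x) * q [tuple of behead x])).
  rewrite -Rintegral_prod//.
  - apply: eq_Rintegral => -[x t] _ /=; congr (_ * q _).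
    by apply/val_inj.
  - exact: measurable_cube.
  - exact: leb_cube_fin.
  - exact: bmeasS.
  - exact: bmeasS.
by apply: bmeasM; [exact: bmeas_thead|exact: bmeas_behead].
Qed.

End tuple_integral.

(** * Orthonormality of exponentials *)

Section exponentials.
Context (R : realType).
Implicit Types (x y t : R) (k : int).

Lemma expi0 : expi (0 : R) = 1.
Proof. by rewrite /expi cos0 sin0. Qed.

Lemma expiD x y : expi (x + y) = expi x * expi y.
Proof.
by apply: complex_eq; rewrite ?Re_mul ?Im_mul /= ?cosD ?sinD //; ring.
Qed.

Lemma expi_conj x : (expi x)^* = expi (- x).
Proof. by apply: complex_eq; rewrite ?Re_conj ?Im_conj /= ?cosN ?sinN. Qed.

Lemma sqabs_expi x : sqabs (expi x) = 1.
Proof. by rewrite /sqabs /= cos2Dsin2. Qed.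

Lemma expi_sum (I : Type) (s : seq I) (F : I -> R) :
  expi (\sum_(i <- s) F i) = \prod_(i <- s) expi (F i).
Proof. by elim/big_ind2 : _ => [|x1 x2 y1 y2 <- <-|]; [exact: expi0|rewrite expiD|]. Qed.

Lemma expi_2pi_int k : expi (2 * pi * k%:~R : R) = 1.
Proof.
have nat_case n : expi (2 * pi * n%:R : R) = 1.
  elim: n => [|n IH]; first by rewrite mulr0 expi0.
  rewrite -[n.+1]addn1 natrD mulrDr mulr1 expiD IH mul1r.
  have -> : 2 * pi = pi *+ 2 :> R by rewrite mulr_natl.
  by rewrite /expi cos2pi sin2pi.
case: k => n; first by rewrite -pmulrn nat_case.
rewrite NegzE mulrNz mulrN -pmulrn -expi_conj nat_case.
exact: (conj_real 1).
Qed.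

Lemma Rintegral_FTC2 (f F : R -> R) (a b : R) : a < b -> continuous f ->
  (forall x, is_derive x 1 F (f x)) ->
  \int[lebesgue_measure]_(x in `[a, b]) f x = F b - F a.
Proof.
move=> ab cf dF; rewrite /Rintegral.
have cF : continuous F.
  by move=> x; apply: differentiable_continuous; apply/derivable1_diffP; case: (dF x).
rewrite (@continuous_FTC2 _ f F)//.
- exact: continuous_subspaceT.
- split.
  + by move=> x _; case: (dF x).
  + by apply: cvg_at_right_filter; exact: cF.
  + by apply: cvg_at_left_filter; exact: cF.
- by move=> x _; rewrite derive1E; exact: derive_val.
Qed.

(** One system covers both boxes: the period [s] is [2 a] with left end [l = - a]
    for the Korobov space on the box, and [1] with [l = 0] for the unit cube. *)
Section period.
Variables (l s : R).
Hypothesis s_gt0 : 0 < s.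

Definition period_itv : set R := `[l, l + s].

Definition period_exp k t : R[i] :=
  (Num.sqrt s)^-1%:C * expi (2 * pi * k%:~R * ((t - l) / s)).

Lemma lebesgue_period_itv : lebesgue_measure period_itv = s%:E.
Proof.
by rewrite lebesgue_measure_itv/= lte_fin ltrDl s_gt0 -EFinB addrAC subrr add0r.
Qed.

Lemma sqabs_period_exp k t : sqabs (period_exp k t) = s^-1.
Proof.
by rewrite sqabsM sqabs_expi mulr1 sqabs_real exprVn sqr_sqrtr// ltW.
Qed.

Lemma continuous_angle k : continuous (fun t : R => 2 * pi * k%:~R * ((t - l) / s)).
Proof.
move=> t; apply: cvgM; first exact: cvg_cst.
by apply: cvgM; [apply: cvgB; [exact: cvg_id|exact: cvg_cst]|exact: cvg_cst].
Qed.

Lemma period_exp_mul_conj k k' t :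
  period_exp k t * (period_exp k' t)^* =
  (s^-1)%:C * expi (2 * pi * (k - k')%:~R * ((t - l) / s)).
Proof.
rewrite /period_exp rmorphM/= conj_real expi_conj mulrACA -rmorphM/= -expiD.
rewrite -invfM -expr2 sqr_sqrtr ?ltW//; congr (_ * expi _).
by rewrite intrB; ring.
Qed.

Lemma Rintegral_expi_period k : k != 0 ->
  \int[lebesgue_measure]_(t in period_itv)
    complex.Re (expi (2 * pi * k%:~R * ((t - l) / s))) = 0 /\
  \int[lebesgue_measure]_(t in period_itv)
    complex.Im (expi (2 * pi * k%:~R * ((t - l) / s))) = 0.
Proof.
move=> k0; pose th := 2 * pi * k%:~R / s : R.
have th0 : th != 0.
  apply: mulf_neq0; last by rewrite invr_eq0 gt_eqF.
  by apply: mulf_neq0; rewrite ?intr_eq0// mulf_neq0// gt_eqF// pi_gt0.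
have angE t : 2 * pi * k%:~R * ((t - l) / s) = th * (t - l).
  by rewrite /th; ring.
have expi_l : expi (th * (l - l)) = 1 by rewrite subrr mulr0 expi0.
have expi_ls : expi (th * (l + s - l)) = 1.
  rewrite -(expi_2pi_int k); congr expi; rewrite /th.
  by field; rewrite gt_eqF.
have ls : l < l + s by rewrite ltrDl.
have cang : continuous (fun t : R => th * (t - l)).
  move=> t; apply: cvgM; first exact: cvg_cst.
  by apply: cvgB; [exact: cvg_id|exact: cvg_cst].
under eq_Rintegral do rewrite angE /=.
under [X in _ /\ X = _]eq_Rintegral do rewrite angE /=.
split.
  have dF (t : R) : is_derive t 1 (fun t => th^-1 * sin (th * (t - l)))
      (cos (th * (t - l))).
    by apply: is_derive_eq; rewrite /GRing.scale/=; field.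
  rewrite (Rintegral_FTC2 ls _ dF); last first.
    by move=> t; apply: continuous_comp; [exact: cang|exact: continuous_cos].
  by move: expi_l expi_ls => [_ ->] [_ ->]; rewrite subrr.
have dF (t : R) : is_derive t 1 (fun t => - th^-1 * cos (th * (t - l)))
    (sin (th * (t - l))).
  by apply: is_derive_eq; rewrite /GRing.scale/=; field.
rewrite (Rintegral_FTC2 ls _ dF); last first.
  by move=> t; apply: continuous_comp; [exact: cang|exact: continuous_sin].
by move: expi_l expi_ls => [-> _] [-> _]; rewrite subrr.
Qed.

Lemma bmeas_period_exp k :
  bmeas (setT : set (measurableTypeR R)) (fun t => complex.Re (period_exp k t)) /\
  bmeas (setT : set (measurableTypeR R)) (fun t => complex.Im (period_exp k t)).
Proof.
have cc (g : R -> R) : continuous g -> (forall x, `|g x| <= 1) ->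
    bmeas (setT : set (measurableTypeR R))
      (fun t => (Num.sqrt s)^-1 * g (2 * pi * k%:~R * ((t - l) / s))).
  move=> cg g1; apply: bmeasZ; split; last by exists 1 => x _; exact: g1.
  apply: continuous_measurable_fun => t.
  by apply: continuous_comp; [exact: continuous_angle|exact: cg].
split.
  under eq_fun do rewrite /period_exp Re_mul /= mul0r subr0.
  by apply: cc; [exact: continuous_cos|exact: cos_max].
under eq_fun do rewrite /period_exp Im_mul /= mul0r addr0.
by apply: cc; [exact: continuous_sin|exact: sin_max].
Qed.

End period.
End exponentials.

Section tensor_product.
Context (R : realType) (D1 : set R).
Hypotheses (mD1 : measurable (D1 : set (measurableTypeR R)))
  (fD1 : (@lebesgue_measure R D1 < +oo)%E).

Definition cbmeas1 (g : R -> R[i]) :=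
  cgood (bmeas (setT : set (measurableTypeR R))) g.

Definition cintegral1 (g : R -> R[i]) : R[i] :=
  (\int[lebesgue_measure]_(x in D1) complex.Re (g x))
  +i* (\int[lebesgue_measure]_(x in D1) complex.Im (g x)).

Definition tensor n (g : 'I_n -> R -> R[i]) (x : n.-tuple R) : R[i] :=
  \prod_(j < n) g j (tnth x j).

Lemma tensor_recl n (g : 'I_n.+1 -> R -> R[i]) x :
  tensor g x = g ord0 (thead x) * tensor (fun j => g (lift ord0 j)) [tuple of behead x].
Proof.
rewrite /tensor big_ord_recl; congr (_ * _); apply: eq_bigr => j _.
rewrite tnth_behead; congr (g _ (tnth _ _)); apply/val_inj.
by rewrite /= inordK// ltnS.
Qed.

Lemma cbmeas_tensor n (g : 'I_n -> R -> R[i]) : (forall j, cbmeas1 (g j)) ->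
  cbmeas setT (tensor g).
Proof.
elim: n g => [|n IH] g bg.
  have -> : tensor g = fun=> 1 by apply/funext => x; rewrite /tensor big_ord0.
  by split; exact: bmeas_cst.
have -> : tensor g = fun x => g ord0 (thead x) *
    tensor (fun j => g (lift ord0 j)) [tuple of behead x].
  by apply/funext => x; exact: tensor_recl.
apply: cbmeasM.
  split.
    exact: (@bmeas_thead R n (fun t => complex.Re (g ord0 t)) (bg ord0).1).
  exact: (@bmeas_thead R n (fun t => complex.Im (g ord0 t)) (bg ord0).2).
have [t1 t2] := IH (fun j => g (lift ord0 j)) (fun j => bg _).
pose G := tensor (fun j => g (lift ord0 j)).
split; first exact: (@bmeas_behead R n (fun t => complex.Re (G t)) t1).
exact: (@bmeas_behead R n (fun t => complex.Im (G t)) t2).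
Qed.

(** Fubini, one coordinate at a time along the inductive construction of the
    measure on tuples. *)
Lemma cintegral_tensor n (g : 'I_n -> R -> R[i]) : (forall j, cbmeas1 (g j)) ->
  cintegral (cube D1 (n := n)) (tensor g) = \prod_(j < n) cintegral1 (g j).
Proof.
elim: n g => [|n IH] g bg.
  have -> : tensor g = fun=> 1 by apply/funext => x; rewrite /tensor big_ord0.
  rewrite big_ord0; apply: complex_eq => /=.
    rewrite Rintegral_cst ?mul1r; last exact: measurable_cube.
    exact: (congr1 fine (leb_cube mD1 fD1 0)).
  by rewrite Rintegral_cst ?mul0r//; exact: measurable_cube.
rewrite big_ord_recl -IH//.
have -> : tensor g = fun x => g ord0 (thead x) *
    tensor (fun j => g (lift ord0 j)) [tuple of behead x].
  by apply/funext => x; exact: tensor_recl.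
have [p1 p2] := bg ord0.
have [q1 q2] := cbmeas_tensor (fun j => bg (lift ord0 j)).
have mC := measurable_cube mD1 (n := n.+1); have fC := leb_cube_fin mD1 fD1 n.+1.
have b (p : R -> R) (q : n.-tuple R -> R) :
  bmeas (setT : set (measurableTypeR R)) p -> bmeas setT q ->
  bmeas (cube D1 (n := n.+1)) (fun x => p (thead x) * q [tuple of behead x]).
  move=> bp bq; apply: (@bmeasS _ _ R _ (fun x => p (thead x) * q [tuple of behead x])).
  by apply: bmeasM; [exact: bmeas_thead|exact: bmeas_behead].
have brr := b _ _ p1 q1; have bii := b _ _ p2 q2.
have bri := b _ _ p1 q2; have bir := b _ _ p2 q1.
have ReE (u v : R) : complex.Re (u +i* v) = u by [].
have ImE (u v : R) : complex.Im (u +i* v) = v by [].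
rewrite /cintegral /cintegral1.
apply: complex_eq; rewrite ?Re_mul ?Im_mul !ReE !ImE.
  under eq_Rintegral do rewrite Re_mul -mulN1r.
  rewrite (Rintegral_bmeasD mC fC brr (bmeasZ (-1) bii)).
  rewrite (Rintegral_bmeasZ mC fC _ bii) mulN1r; congr (_ - _).
    exact: (Rintegral_tensor mD1 fD1 p1 q1).
  exact: (Rintegral_tensor mD1 fD1 p2 q2).
under eq_Rintegral do rewrite Im_mul.
rewrite (Rintegral_bmeasD mC fC bri bir); congr (_ + _).
  exact: (Rintegral_tensor mD1 fD1 p1 q2).
exact: (Rintegral_tensor mD1 fD1 p2 q1).
Qed.

End tensor_product.

Section tensor_exponentials.
Context (R : realType) (l s : R) (n : nat).
Hypothesis s_gt0 : 0 < s.

Definition tensor_exp (h : 'rV[int]_n) : n.-tuple R -> R[i] :=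
  tensor (fun j => period_exp l s (h 0 j)).

Lemma cintegral1_period_exp k k' :
  cintegral1 (period_itv l s)
    (fun t => period_exp l s k t * (period_exp l s k' t)^*) = (k == k')%:R.
Proof.
pose E t := expi (2 * pi * (k - k')%:~R * ((t - l) / s)).
have mI : measurable (period_itv l s : set (measurableTypeR R)) by exact: measurable_itv.
have fI : (lebesgue_measure (period_itv l s) < +oo)%E by rewrite lebesgue_period_itv// ltry.
rewrite (_ : (fun t => _) = fun t => (s^-1)%:C * E t); last first.
  by apply/funext => t; exact: period_exp_mul_conj.
have [kk'|kk'] := eqVneq k k'.
  rewrite (_ : (fun t => _) = fun=> (s^-1)%:C); last first.
    by apply/funext => t; rewrite /E kk' subrr mulr0z !mulr0 mul0r expi0 mulr1.
  apply: complex_eq; rewrite /= Rintegral_cst//= ?mul0r//.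
  by rewrite lebesgue_period_itv//= mulVf ?gt_eqF.
have k0 : k - k' != 0 by rewrite subr_eq0.
have [r0 i0] := Rintegral_expi_period l s_gt0 k0.
have bE (g : R -> R) : continuous g -> (forall x, `|g x| <= 1) ->
    bmeas (period_itv l s : set (measurableTypeR R))
      (fun t => g (2 * pi * (k - k')%:~R * ((t - l) / s))).
  move=> cg g1; split; last by exists 1 => x _; exact: g1.
  apply: measurable_funTS; apply: continuous_measurable_fun => t.
  by apply: continuous_comp; [exact: continuous_angle|exact: cg].
have ReE t : complex.Re ((s^-1)%:C * E t) = s^-1 * complex.Re (E t).
  by rewrite Re_mul [X in _ - X]mul0r subr0.
have ImE t : complex.Im ((s^-1)%:C * E t) = s^-1 * complex.Im (E t).
  by rewrite Im_mul [X in _ + X]mul0r addr0.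
rewrite /cintegral1.
under [X in X +i* _]eq_Rintegral do rewrite ReE.
under [X in _ +i* X]eq_Rintegral do rewrite ImE.
rewrite !(Rintegral_bmeasZ mI fI) /E ?r0 ?i0 ?mulr0//.
  by apply: bE; [exact: continuous_sin|exact: sin_max].
by apply: bE; [exact: continuous_cos|exact: cos_max].
Qed.

Lemma bounded_orthonormal_exp :
  bounded_orthonormal (cube (period_itv l s) (n := n)) (s^-1 ^+ n) tensor_exp.
Proof.
have mI : measurable (period_itv l s : set (measurableTypeR R)) by exact: measurable_itv.
have fI : (lebesgue_measure (period_itv l s) < +oo)%E by rewrite lebesgue_period_itv// ltry.
split.
- exact: measurable_cube.
- exact: leb_cube_fin.
- by move=> h; apply: cbmeas_tensor => j; exact: bmeas_period_exp.
- move=> h x; rewrite /tensor_exp /tensor.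
  rewrite (_ : s^-1 ^+ n = \prod_(j < n) s^-1); last by rewrite prodr_const card_ord.
  elim/big_ind2 : _ => [|x1 x2 y1 y2 <- <-|j _].
  + by rewrite (sqabs_real 1) expr1n.
  + exact: sqabsM.
  + exact: sqabs_period_exp.
- move=> h k; rewrite /l2inner.
  pose g j t := period_exp l s (h 0 j) t * (period_exp l s (k 0 j) t)^*.
  have bg j : cbmeas1 (g j).
    have b k' := bmeas_period_exp l s k'; split.
      under eq_fun do rewrite Re_mul Re_conj Im_conj mulrN opprK.
      by apply: bmeasD; apply: bmeasM; have [] := b (h 0 j); have [] := b (k 0 j).
    under eq_fun do rewrite Im_mul Re_conj Im_conj mulrN -mulN1r.
    by apply: bmeasD; [apply: bmeasZ|]; apply: bmeasM;
      have [] := b (h 0 j); have [] := b (k 0 j).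
  transitivity (cintegral (cube (period_itv l s) (n := n)) (tensor g)).
    congr cintegral; apply/funext => x.
    by rewrite /tensor_exp /tensor rmorph_prod -big_split.
  rewrite cintegral_tensor//.
  under eq_bigr do rewrite cintegral1_period_exp.
  have [->|hk] := eqVneq h k; first by rewrite big1// => j _; rewrite eqxx.
  have /existsP[j hkj] : [exists j, h 0 j != k 0 j].
    rewrite -negb_forall; apply: contra hk => /forallP hk.
    by apply/eqP/rowP => j; exact/eqP.
  by rewrite (bigD1 j)//= (negbTE hkj) mul0r.
Qed.

End tensor_exponentials.

(** * Lattice sums and the zeta function *)

Section zeta_series.
Context (R : realType) (s : R).
Hypothesis s_gt1 : 1 < s.

Let u (n : nat) : R := n.+1%:R `^ (- s).
Let q : R := 2 `^ (1 - s).

Let q_lt1 : q < 1.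
Proof.
rewrite /q /powR pnatr_eq0/= expR_lt1 pmulr_llt0 ?subr_lt0//.
by rewrite ln_gt0// ltr1n.
Qed.

Let dyadic_bound k : \sum_(0 <= i < (2 ^ k).-1) u i <= \sum_(0 <= j < k) q ^+ j.
Proof.
elim: k => [|k IH]; first by rewrite !big_nil.
have p0 : (0 < 2 ^ k)%N by rewrite expn_gt0.
rewrite big_nat_recr//= (@big_cat_nat _ _ _ (2 ^ k).-1)//=; last first.
  by rewrite -!subn1 leq_sub2r// leq_exp2l.
apply: lerD => //.
rewrite (_ : q ^+ k = \sum_((2 ^ k).-1 <= i < (2 ^ k.+1).-1) (2 ^ k)%:R `^ (- s)).
  rewrite big_nat [leRHS]big_nat; apply: ler_sum => i /andP[ki _].
  rewrite /u !powRN lef_pV2 ?posrE ?powR_gt0 ?ltr0n//.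
  apply: ge0_ler_powR; rewrite ?nnegrE//; first by rewrite (le_trans ler01)// ltW.
  by rewrite ler_nat -(prednK p0) ltnS.
rewrite sumr_const_nat.
have -> : ((2 ^ k.+1).-1 - (2 ^ k).-1 = 2 ^ k)%N.
  rewrite expnS mul2n -addnn; move: p0; case: (2 ^ k)%N => // m _.
  by rewrite addSn [(_.+1).-1]/= addKn.
have pk : 0 < (2 ^ k)%:R :> R by rewrite ltr0n.
rewrite -[RHS]mulr_natl -{1}(powRr1 (ltW pk)) -powRD; last first.
  by apply/implyP => _; rewrite gt_eqF.
rewrite natrX -(powR_mulrn k (powR_ge0 _ _)) -(powR_mulrn k (ler0n R 2)).
rewrite /q -!powRrM; congr (_ `^ _).
by rewrite mulrC.
Qed.

Let partial_bound n : \sum_(0 <= i < n) u i <= (1 - q)^-1.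
Proof.
have u0 i : 0 <= u i by exact: powR_ge0.
have nk : (n <= (2 ^ n).-1)%N by rewrite -ltnS prednK ?expn_gt0// ltn_expl.
apply: le_trans (le_trans (dyadic_bound n) _).
  rewrite [leRHS](@big_cat_nat _ _ _ n)//= lerDl; apply: sumr_ge0 => i _; exact: u0.
have q1 : 0 < 1 - q by rewrite subr_gt0.
rewrite -[leRHS]mul1r ler_pdivlMr// mulrC big_mkord.
have -> : (1 - q) * (\sum_(i < n) q ^+ i) = 1 - q ^+ n.
  by rewrite -opprB mulNr -subrX1 opprB.
by rewrite gerBl exprn_ge0// powR_ge0.
Qed.

(** The series converges by Cauchy condensation: the dyadic block of length [2^k]
    contributes at most [q^k] with [q = 2^(1 - s) < 1]. *)
Lemma esum_zeta : \esum_(n in [set: nat]) (u n)%:E = (zeta s)%:E.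
Proof.
rewrite -nneseries_esumT; last by move=> n; rewrite lee_fin powR_ge0.
rewrite /zeta -EFin_lim.
  by congr (limn _); apply/funext => n /=; rewrite sumEFin.
apply: nondecreasing_is_cvgn.
  by apply/nondecreasing_series => n _ _; exact: powR_ge0.
by exists (1 - q)^-1 => _ [n _ <-]; exact: partial_bound.
Qed.

End zeta_series.

Section lattice_sums.
Context (R : realType).

Lemma esum_int (f : int -> \bar R) : (forall k, 0 <= f k)%E ->
  (\esum_(k in [set: int]) f k =
   f 0%R + (\esum_(n in [set: nat]) f (Posz n.+1) + \esum_(n in [set: nat]) f (Negz n)))%E.
Proof.
move=> f0; rewrite (esumID [set (0 : int)])// setTI esum_set1//; congr (_ + _)%E.
rewrite (esumID (range (fun n => Posz n.+1)))//; congr (_ + _)%E.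
  rewrite (@reindex_esum R nat int [set: nat] _ (fun n => Posz n.+1))//.
  split => [n _|m n _ _ []//|k []]; first by split; [split|exists n].
  by move=> [_ k0] [n _ <-]; exists n.
rewrite (@reindex_esum R nat int [set: nat] _ (fun n => Negz n))//.
split => [n _|m n _ _ []//|k []]; first by split; [split|case=> m _].
move=> [_ k0] kP; case: k k0 kP => [[/(_ erefl)//|n]|n] k0 kP.
  by exfalso; apply: kP; exists n.
by exists n.
Qed.

Lemma rsum_prod n (w : int -> R) : (forall k, 0 <= w k) -> rsummable w ->
  rsummable (fun h : 'rV[int]_n => \prod_(j < n) w (h 0 j)) /\
  rsum (fun h : 'rV[int]_n => \prod_(j < n) w (h 0 j)) = rsum w ^+ n.
Proof.
move=> w0 sw.
have p0 m (h : 'rV[int]_m) : 0 <= \prod_(j < m) w (h 0 j).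
  by apply: prodr_ge0 => j _.
suff E : \esum_(h in [set: 'rV[int]_n]) (\prod_(j < n) w (h 0 j))%:E =
    (rsum w ^+ n)%:E.
  have sp : rsummable (fun h : 'rV[int]_n => \prod_(j < n) w (h 0 j)).
    by apply: rsummable_ge0 => //; rewrite E ltry.
  by split => //; apply: EFin_inj; rewrite EFin_rsum.
elim: n => [|n IH].
  have [sF eF] : rsummable (fun h : 'rV[int]_0 => \prod_(j < 0) w (h 0 j)) /\
      rsum (fun h : 'rV[int]_0 => \prod_(j < 0) w (h 0 j)) = 1.
    have [|sF ->] := @rsum_eq1 R _ (fun h : 'rV[int]_0 => \prod_(j < 0) w (h 0 j)) 0.
      by move=> h; rewrite (thinmx0 h) eqxx.
    by rewrite big_ord0.
  by rewrite -EFin_rsum// eF expr0.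
pose g (p : int * 'rV[int]_n) : 'rV[int]_n.+1 :=
  \row_j (if unlift ord0 j is Some i then p.2 0 i else p.1).
have gb : set_bij [set: int * 'rV[int]_n] [set: 'rV[int]_n.+1] g.
  split => // [[k h] [k' h'] _ _ /rowP e|h _].
    congr (_, _); first by have := e ord0; rewrite !mxE unlift_none.
    by apply/rowP => i; have := e (lift ord0 i); rewrite !mxE liftK.
  exists (h 0 ord0, \row_i h 0 (lift ord0 i)) => //.
  by apply/rowP => j; rewrite mxE; case: unliftP => [i ->|->]; rewrite /= ?mxE.
rewrite (@reindex_esum R _ _ _ _ g (fun h => (\prod_(j < n.+1) w (h 0 j))%:E) gb).
have gE p : (\prod_(j < n.+1) w (g p 0 j))%:E =
    ((w p.1)%:E * (\prod_(j < n) w (p.2 0 j))%:E)%E.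
  rewrite big_ord_recl EFinM !mxE unlift_none; congr (_ * (_)%:E)%E.
  by apply: eq_bigr => j _; rewrite !mxE liftK.
under eq_esum do rewrite gE.
have := @esum_esum R int 'rV[int]_n [set: int] (fun=> [set: 'rV[int]_n])
  (fun k h => ((w k)%:E * (\prod_(j < n) w (h 0 j))%:E)%E).
rewrite (_ : [set: int] `*`` (fun=> [set: 'rV[int]_n]) = [set: int * 'rV[int]_n]); last first.
  by apply/seteqP; split.
move=> <-; last by move=> k h _ _; rewrite mule_ge0 ?lee_fin.
have inner k : (\esum_(h in [set: 'rV[int]_n])
    ((w k)%:E * (\prod_(j < n) w (h 0 j))%:E) = (rsum w ^+ n)%:E * (w k)%:E)%E.
  by rewrite esumZl ?IH 1?muleC// => h; rewrite lee_fin.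
under eq_esum do rewrite inner.
rewrite esumZl; last 2 first.
- by rewrite exprn_ge0// rsum_ge0.
- by move=> k; rewrite lee_fin.
by rewrite -EFin_rsum// -EFinM exprSr.
Qed.

End lattice_sums.

Section box_weights.
Context (R : realType) (alpha : nat) (a : R).
Hypotheses (alpha_gt0 : (0 < alpha)%N) (a_gt0 : 0 < a).

Lemma rbox1_gt0 k : 0 < rbox1 alpha a k.
Proof.
rewrite /rbox1; case: eqVneq => [_|k0]; first by rewrite sqrtr_gt0 mulr_gt0.
rewrite exprn_gt0// normr_gt0; apply: mulf_neq0; last by rewrite invr_eq0 gt_eqF.
by apply: mulf_neq0; rewrite ?intr_eq0// gt_eqF// pi_gt0.
Qed.

Lemma rbox_gt0 d (h : 'rV[int]_d) : 0 < rbox alpha a h.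
Proof. by apply: prodr_gt0 => j _; exact: rbox1_gt0. Qed.

(** The term [0] gives the first summand, and the terms [k] and [- k] for [k > 0]
    together give the zeta function. *)
Lemma rsum_rbox1_powR (tau : R) : 1 < 2 * alpha%:R * tau -> 0 < tau ->
  rsummable (fun k => rbox1 alpha a k `^ (- (2 * tau))) /\
  rsum (fun k => rbox1 alpha a k `^ (- (2 * tau))) =
  (2 * a) `^ (- tau) +
  2 * ((a / pi) `^ (2 * alpha%:R * tau) * zeta (2 * alpha%:R * tau)).
Proof.
move=> tau1 tau0.
have a2 : 0 < 2 * a by rewrite mulr_gt0.
have w0 : rbox1 alpha a 0 `^ (- (2 * tau)) = (2 * a) `^ (- tau).
  rewrite /rbox1 eqxx -powR12_sqrt ?(ltW a2)// -powRrM; congr (_ `^ _).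
  by field.
have wn n k : `|k| = n.+1%:Z -> rbox1 alpha a k `^ (- (2 * tau)) =
    (a / pi) `^ (2 * alpha%:R * tau) * n.+1%:R `^ (- (2 * alpha%:R * tau)).
  move=> kn; have k0 : k != 0 by rewrite -normr_eq0 kn.
  rewrite /rbox1 (negbTE k0) normrM normfV normrM.
  rewrite (ger0_norm (pi_ge0 R)) (gtr0_norm a_gt0) -intr_norm kn -pmulrn.
  have pa : 0 < pi / a by rewrite divr_gt0// pi_gt0.
  rewrite (_ : pi * _ / a = pi / a * n.+1%:R); last by ring.
  rewrite -powR_mulrn; last by rewrite mulr_ge0// ltW.
  rewrite -powRrM powRM//; last exact: ltW.
  rewrite (_ : alpha%:R * - (2 * tau) = - (2 * alpha%:R * tau)); last by ring.
  have -> : a / pi = (pi / a) `^ (-1) by rewrite powR_inv1 ?(ltW pa)// invf_div.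
  by rewrite -powRrM mulN1r.
have wp n := wn n (Posz n.+1) erefl; have wm n := wn n (Negz n) erefl.
have f0 k : (0 <= (rbox1 alpha a k `^ (- (2 * tau)))%:E)%E by rewrite lee_fin powR_ge0.
have c0 : 0 <= (a / pi) `^ (2 * alpha%:R * tau) by exact: powR_ge0.
have E : (\esum_(k in [set: int]) (rbox1 alpha a k `^ (- (2 * tau)))%:E =
  ((2 * a) `^ (- tau) +
  2 * ((a / pi) `^ (2 * alpha%:R * tau) * zeta (2 * alpha%:R * tau)))%:E)%E.
  rewrite esum_int// w0.
  under eq_esum do rewrite wp EFinM.
  under [X in (_ + (_ + X))%E]eq_esum do rewrite wm EFinM.
  rewrite esumZl//.
  by rewrite esum_zeta// -!EFinM -!EFinD; congr (_%:E); ring.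
have s : rsummable (fun k => rbox1 alpha a k `^ (- (2 * tau))).
  by apply: rsummable_ge0 => [k|]; [exact: powR_ge0|rewrite E ltry].
by split=> //; apply: EFin_inj; rewrite EFin_rsum// => k; exact: powR_ge0.
Qed.

Lemma powR_rbox d (h : 'rV[int]_d) x :
  rbox alpha a h `^ x = \prod_(j < d) rbox1 alpha a (h 0 j) `^ x.
Proof.
rewrite /rbox; apply: (@proj2 (0 <= \prod_(j < d) rbox1 alpha a (h 0 j))).
elim/big_ind2 : _ => [|x1 x2 y1 y2 [? <-] [? <-]|j _].
- by rewrite powR1 ler01.
- by rewrite powRM// mulr_ge0.
- by rewrite ltW ?rbox1_gt0.
Qed.

Lemma rsum_rbox_powR d (tau : R) : 1 < 2 * alpha%:R * tau -> 0 < tau ->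
  rsummable (fun h : 'rV[int]_d => rbox alpha a h `^ (- (2 * tau))) /\
  rsum (fun h : 'rV[int]_d => rbox alpha a h `^ (- (2 * tau))) =
  ((2 * a) `^ (- tau) +
  2 * ((a / pi) `^ (2 * alpha%:R * tau) * zeta (2 * alpha%:R * tau))) ^+ d.
Proof.
move=> tau1 tau0; have [s1 e1] := rsum_rbox1_powR tau1 tau0.
under eq_fun do rewrite powR_rbox.
rewrite -e1; apply: rsum_prod => // k; exact: powR_ge0.
Qed.

Lemma rsummable_rbox d : rsummable (fun h : 'rV[int]_d => rbox alpha a h ^- 2).
Proof.
have [||s _] := @rsum_rbox_powR d 1; rewrite ?mulr1//.
  by rewrite -natrM ltr1n; case: alpha alpha_gt0 => // n _; rewrite mulnS.
move: s; congr rsummable; apply/funext => h.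
by rewrite mulr1 powR_invn// ltW// rbox_gt0.
Qed.

End box_weights.

(** On a box of side one the scaled weights are the weights of the unit cube; this
    carries the summability of the former over to the latter. *)
Lemma rweight_rbox (R : realType) (alpha d : nat) (h : 'rV[int]_d) :
  rweight alpha h = rbox alpha (1 / 2 : R) h.
Proof.
apply: eq_bigr => j _; rewrite /r1 /rbox1; case: ifP => _.
  by rewrite mul1r mulfV// sqrtr1.
by congr (`|_| ^+ _); field.
Qed.

(** There is equality in the coordinates where [h] does not vanish; in the others
    the left factor is [1] and the right one [(2 a)^(2 alpha + 1)]. *)
Lemma rweight_le_rbox (R : realType) (alpha : nat) (a : R) (d : nat)
    (h : 'rV[int]_d) : 1 <= 2 * a ->
  rweight alpha h ^+ 2 <= (2 * a) ^+ (2 * alpha * d) * rbox alpha a h ^+ 2.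
Proof.
move=> a1; have a0 : 0 < a by lra.
have -> : (2 * a) ^+ (2 * alpha * d) = \prod_(j < d) (2 * a) ^+ (2 * alpha).
  by rewrite prodr_const card_ord exprM.
rewrite /rbox /rweight -!prodrXl -big_split/=; apply: ler_prod => j _.
apply/andP; split; first exact: sqr_ge0.
rewrite /r1 /rbox1; case: ifP => _.
  rewrite sqr_sqrtr; last by lra.
  by rewrite expr1n mulr_ege1// exprn_ege1.
have -> : `|2 * pi * (h 0 j)%:~R| = 2 * a * `|pi * (h 0 j)%:~R / a| :> R.
  rewrite -{1}(@gtr0_norm _ (2 * a)); last by lra.
  by rewrite -normrM; congr `|_|; field; rewrite gt_eqF.
by rewrite exprMn exprMn -exprM mulnC.
Qed.

(** * Expectations under a density and under independence *)

Section expectation_density.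
Context (R : realType) (d : nat) (dO : measure_display)
  (Omega : measurableType dO) (P : probability Omega R) (D : set (d.-tuple R))
  (f : d.-tuple R -> R) (Y : {RV P >-> d.-tuple R}).
Hypotheses (mD : measurable D) (muD : (leb R d D < +oo)%E)
  (bf : bmeas D f)
  (Yf : has_density_on D f Y).

Let nu := distribution P Y.
Let mu := leb R d.
Let fD : d.-tuple R -> \bar R := (EFin \o f) \_ D.

Let mfD : measurable_fun setT fD.
Proof. by apply/(measurable_restrictT _ mD)/measurable_EFinP; exact: bf.1. Qed.

Let nuE A : measurable A -> nu A = (\int[mu]_(x in A) fD x)%E.
Proof. by move=> mA; rewrite /nu Yf// /fD integral_mkcondr. Qed.

Let nu_mu : nu `<< mu.
Proof.
move=> N N0 A mA AN; rewrite nuE// null_set_integral//; last exact: N0.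
exact: measurable_funTS.
Qed.

Let g := Radon_Nikodym_SigmaFinite.f nu mu.

Let ae_fg : ae_eq mu setT g fD.
Proof.
apply: integral_ae_eq => //; first exact: Radon_Nikodym_SigmaFinite.f_integrable.
by move=> A _ mA; rewrite -Radon_Nikodym_SigmaFinite.f_integral// -nuE.
Qed.

Let expectation_ge0 (u : d.-tuple R -> R) : bmeas setT u -> (forall x, 0 <= u x) ->
  (\int[P]_w (u (Y w))%:E = \int[mu]_(x in D) (f x * u x)%:E)%E.
Proof.
move=> [mu_ [M uM]] u0.
have mu' : measurable_fun setT (EFin \o u) by apply/measurable_EFinP.
rewrite -(@ge0_integral_distribution _ _ _ _ _ P Y (EFin \o u))//.
rewrite -(Radon_Nikodym_SigmaFinite.change_of_variables nu_mu)//.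
transitivity (\int[mu]_x ((u x)%:E * fD x))%E.
  apply: ae_eq_integral => //.
  - apply: emeasurable_funM => //; apply: measurable_int.
    exact: Radon_Nikodym_SigmaFinite.f_integrable.
  - exact: emeasurable_funM.
  - exact: ae_eqe_mul2l.
rewrite [RHS]integral_mkcond; apply: eq_integral => x _.
by rewrite /fD !patchE; case: ifPn; rewrite ?mule0// => _; rewrite -EFinM mulrC.
Qed.

(** The density agrees almost everywhere with the Radon-Nikodym derivative of the
    distribution, which gives the formula for nonnegative [u]; a bounded [u]
    becomes nonnegative after adding a constant. *)
Lemma Rintegral_density (u : d.-tuple R -> R) : bmeas setT u ->
  \int[P]_w u (Y w) = \int[leb R d]_(x in D) (f x * u x).
Proof.
have case0 v : bmeas setT v -> (forall x, 0 <= v x) ->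
    \int[P]_w v (Y w) = \int[leb R d]_(x in D) (f x * v x).
  by move=> bv v0; rewrite /Rintegral expectation_ge0.
have PT : (P setT < +oo)%E by rewrite probability_setT ltry.
have bY (v : d.-tuple R -> R) : bmeas setT v -> bmeas setT (fun w => v (Y w)).
  exact: bmeas_comp.
move=> bu; have [mu_ [M uM]] := bu.
have bM : bmeas (setT : set (d.-tuple R)) (fun=> M) by exact: bmeas_cst.
have M0 (x : d.-tuple R) : 0 <= M by exact: le_trans (normr_ge0 (u x)) (uM x I).
have uM0 x : 0 <= u x + M.
  by have := uM x I; rewrite ler_norml => /andP[+ _]; rewrite -lerBlDr sub0r.
have E : \int[leb R d]_(x in D) (f x * (u x + M)) =
    \int[leb R d]_(x in D) (f x * u x + f x * M).
  by apply: eq_Rintegral => x _; rewrite mulrDr.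
have := case0 (fun x => u x + M) (bmeasD bu bM) uM0.
rewrite E (Rintegral_bmeasD measurableT PT (bY _ bu) (bY _ bM)).
rewrite (Rintegral_bmeasD mD muD (bmeasM bf (bmeasS D bu)) (bmeasM bf (bmeasS D bM))).
rewrite (case0 (fun=> M) bM M0).
by move/addIr.
Qed.

End expectation_density.

Section independent_product.
Context (R : realType) (dO dT : measure_display) (Omega : measurableType dO)
  (T : measurableType dT) (P : probability Omega R) (M : nat)
  (Y : 'I_M -> {RV P >-> T}).
Hypothesis indep : mutually_independent Y.
Variables (i j : 'I_M).
Hypothesis ij : i != j.

Let pairY w := (Y i w, Y j w).

Let mpairY : measurable_fun setT pairY.
Proof. exact: measurable_fun_pair. Qed.

Let joint_distribution (A : set (T * T)) : measurable A ->
  (distribution P (Y i) \x distribution P (Y j))%E A = pushforward P pairY A.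
Proof.
pose m' : {measure set (T * T) -> \bar R} :=
  measure_function_pushforward__canonical__measure_function_Measure P mpairY.
apply: (@product_measure_unique _ _ _ _ R _ _ m') => B C mB mC.
have mBC m : measurable ((fun m : 'I_M => if m == i then B else C) m).
  by case: ifP.
have := indep [set i; j]%SET mBC.
rewrite big_setU1 ?inE//= big_set1 eqxx eq_sym (negbTE ij) => <-.
rewrite /m' /= /pushforward; congr (P _).
apply/seteqP; split => [w [/= Bw Cw] m|w /= H].
  rewrite !inE; case: eqP => [-> _|_ /eqP ->] //.
split => /=; first by have := H i; rewrite !inE eqxx; apply.
by have := H j; rewrite !inE eqxx orbT eq_sym (negbTE ij); apply.
Qed.

(** Independence says that the joint distribution and the product of the
    marginals agree on rectangles, hence everywhere. *)
Lemma Rintegral_indep (u v : T -> R) : bmeas setT u -> bmeas setT v ->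
  \int[P]_w (u (Y i w) * v (Y j w)) =
  (\int[P]_w u (Y i w)) * (\int[P]_w v (Y j w)).
Proof.
move=> bu bv.
have PT : (P setT < +oo)%E by rewrite probability_setT ltry.
have bY k (w : T -> R) : bmeas setT w -> bmeas setT (fun o => w (Y k o)).
  exact: bmeas_comp.
have distE k (w : T -> R) : bmeas setT w ->
    \int[P]_o w (Y k o) = \int[distribution P (Y k)]_y w y.
  move=> bw; rewrite /Rintegral -(@integral_distribution _ _ _ _ _ P (Y k) (EFin \o w))//.
    by apply/measurable_EFinP; exact: bw.1.
  exact: (bmeas_integrable measurableT PT (bY k w bw)).
rewrite !distE// -Rintegral_prod//; do ?by rewrite /= probability_setT ltry.
rewrite setXTT /Rintegral; congr fine.
rewrite (@eq_measure_integral _ _ _ setT (pushforward P pairY)); last first.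
  by move=> A mA _; exact: joint_distribution.
rewrite (@integral_pushforward _ _ _ _ R _ mpairY P setT
  (EFin \o (fun z : T * T => u z.1 * v z.2)))//.
  apply/measurable_EFinP; apply: measurable_funM.
    exact: (measurableT_comp bu.1 measurable_fst).
  exact: (measurableT_comp bv.1 measurable_snd).
exact: (bmeas_integrable measurableT PT (bmeasM (bY i u bu) (bY j v bv))).
Qed.

End independent_product.

(** * Real forms and the Korobov kernel *)

Section real_valued_forms.
Context (R : realType) (d : nat) (D : set (d.-tuple R)) (B : R).
Variable e : 'rV[int]_d -> d.-tuple R -> R[i].
Hypothesis on : bounded_orthonormal D B e.
Variable r : 'rV[int]_d -> R.
Hypotheses (r_gt0 : forall h, 0 < r h)
  (r_sum : rsummable (fun h => r h ^- 2)).
Implicit Types (c : 'rV[int]_d -> R[i]) (u v : d.-tuple R -> R[i]).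

Lemma Re_l2inner c c' u v : csummable c -> csummable c' ->
  (forall x, D x -> u x = trig_series e c x) ->
  (forall x, D x -> v x = trig_series e c' x) ->
  complex.Re (l2inner D u v) = wform (fun=> 1) c c'.
Proof.
move=> sc sc' uE vE; rewrite (parseval on sc sc' uE vE) /=.
by apply: eq_rsum => h; rewrite mulr1.
Qed.

Lemma Rintegral_sqabs c u : csummable c ->
  (forall x, D x -> u x = trig_series e c x) ->
  \int[leb R d]_(x in D) sqabs (u x) = wform (fun=> 1) c c.
Proof.
move=> sc uE; rewrite -(Re_l2inner sc sc uE uE) /=.
by apply: eq_Rintegral => x _; rewrite Re_mul_conj.
Qed.

Lemma bmeas_sqabs c u : csummable c ->
  (forall x, D x -> u x = trig_series e c x) -> bmeas D (fun x => sqabs (u x)).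
Proof.
move=> sc uE.
have [b1 b2] := cbmeasS D (cbmeas_trig_series on sc).
have [m [M bM]] := bmeasD (bmeasM b1 b1) (bmeasM b2 b2).
split; last by exists M => x Dx; rewrite uE// /sqabs !expr2; exact: bM.
apply: eq_measurable_fun m => x /[!inE] Dx.
by rewrite uE// /sqabs !expr2.
Qed.

Lemma Re_kinner c c' u v : wsummable r c -> wsummable r c' ->
  (forall x, D x -> u x = trig_series e c x) ->
  (forall x, D x -> v x = trig_series e c' x) ->
  complex.Re (kinner D e r u v) = wform (fun h => r h ^+ 2) c c'.
Proof.
move=> sc sc' uE vE; apply: eq_rsum => h.
rewrite (fcoefE on r_gt0 r_sum sc uE) (fcoefE on r_gt0 r_sum sc' vE).
by rewrite [LHS]Re_mul /= mulr0 subr0.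
Qed.

(** The reproducing property, at the level of coefficients. *)
Lemma Re_trig_series_kernel c x :
  complex.Re (trig_series e c x) = wform (fun h => r h ^+ 2) c (kernel_coef e r x).
Proof.
apply: eq_rsum => h; rewrite /kernel_coef rmorphM/= conjCK conj_real [c h * (_ * _)]mulrCA.
rewrite [in RHS]Re_mul /= mul0r subr0 mulrAC mulVf ?mul1r//.
by rewrite expf_eq0/= gt_eqF.
Qed.

(** Point evaluation against the weighted norm, again in the arithmetic form
    [2 s t <= s^2 w + t^2 / w] summed over the frequencies. *)
Lemma Re_trig_series_le (w : 'rV[int]_d -> R) c x : (forall h, 0 < w h) ->
  csummable c -> in_weighted_l2 w c -> rsummable (fun h => B / w h) ->
  2 * complex.Re (trig_series e c x) <= wform w c c + rsum (fun h => B / w h).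
Proof.
move=> w0 sc swc sw; rewrite wform_sqabs /trig_series /=.
have sce := (trig_series_summable on x sc).1.
rewrite -rsumZ// -rsumD//; apply: le_rsum => [||h].
- exact: rsummableZ.
- exact: rsummableD.
have wh := w0 h.
have : complex.Re (c h * e h x) <= normc (c h) * normc (e h x).
  by rewrite -normcM (le_trans (ler_norm _) (ler_Re_normc _)).
rewrite -(on_sqabs on h x) -!sqr_normc_sqabs.
move: (complex.Re _) (normc (c h)) (normc (e h x)) => z p q zpq.
have : 0 <= (p * w h - q) ^+ 2 / w h by rewrite divr_ge0 ?sqr_ge0// ltW.
have -> : (p * w h - q) ^+ 2 / w h = p ^+ 2 * w h + q ^+ 2 / w h - 2 * (p * q).
  by field; rewrite gt_eqF.
by move: (_ * w h) (_ / w h) => s t; lra.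
Qed.

Lemma trig_seriesD c c' x : csummable c -> csummable c' ->
  trig_series e (fun h => c h + -1 * c' h) x = trig_series e c x - trig_series e c' x.
Proof.
move=> sc sc'.
have [s1 s2] := trig_series_summable on x sc.
have [t1 t2] := trig_series_summable on x sc'.
have E h : (c h + -1 * c' h) * e h x = c h * e h x - c' h * e h x by ring.
rewrite /trig_series (eq_csum E).
apply: complex_eq; rewrite ?Re_add ?Im_add /=.
  rewrite -rsumN// -rsumD//; last exact: rsummableN.
  by apply: eq_rsum => h; rewrite Re_add; case: (c' h * _).
rewrite -rsumN// -rsumD//; last exact: rsummableN.
by apply: eq_rsum => h; rewrite Im_add; case: (c' h * _).
Qed.

Lemma trig_series_comb n (C : 'I_n -> 'rV[int]_d -> R[i]) (t : 'rV[R]_n) x :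
  (forall k, csummable (C k)) ->
  trig_series e (comb C t) x = \sum_k (t 0 k)%:C * trig_series e (C k) x.
Proof.
move=> sC.
have sk k : csummable (fun h => (t 0 k)%:C * (C k h * e h x)).
  have sk := trig_series_summable on x (sC k).
  exact: (cgoodZ (@rsummableD R _) (@rsummableZ R _) (t 0 k)%:C sk).
transitivity (csum (fun h => \sum_k (t 0 k)%:C * (C k h * e h x))).
  apply: eq_csum => h; rewrite /comb mulr_suml.
  by apply: eq_bigr => k _; rewrite mulrA.
rewrite (csum_sum (index_enum 'I_n) sk).2; apply: eq_bigr => k _.
rewrite csumZ; first by [].
exact: (trig_series_summable on x (sC k)).
Qed.

End real_valued_forms.

Section korobov_box.
Context (R : realType) (alpha d : nat) (a : R).
Hypotheses (alpha_gt0 : (0 < alpha)%N) (a_gt0 : 0 < a).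

Lemma bounded_orthonormal_phi :
  bounded_orthonormal (box a) ((2 * a)^-1 ^+ d) (phi a (d := d)).
Proof.
have a2 : 0 < 2 * a by rewrite mulr_gt0.
have := bounded_orthonormal_exp (- a) d a2.
congr bounded_orthonormal.
  apply/seteqP; split=> x /= H j; have := H j; rewrite /period_itv/= in_itv/=;
    by rewrite (_ : - a + 2 * a = a)//; ring.
by apply/funext => h; apply/funext => x; rewrite /tensor_exp /tensor /period_exp opprK.
Qed.

Lemma bounded_orthonormal_epi :
  bounded_orthonormal unit_box 1 (epi (R := R) (d := d)).
Proof.
have := bounded_orthonormal_exp (0 : R) d ltr01; rewrite invr1 expr1n.
congr bounded_orthonormal.
  by apply/seteqP; split=> x /= H j; have := H j; rewrite /period_itv/= in_itv/= add0r.
apply/funext => h; apply/funext => x; rewrite /tensor_exp /tensor /epi /dot.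
rewrite mulr_sumr expi_sum; apply: eq_bigr => j _.
by rewrite /period_exp sqrtr1 invr1 mul1r subr0 mulr1 mulrA.
Qed.

Lemma phiN (h : 'rV[int]_d) x : phi a (- h) x = (phi a h x)^*.
Proof.
rewrite /phi rmorph_prod; apply: eq_bigr => j _ /=.
rewrite rmorphM/= conj_real expi_conj; congr (_ * expi _).
by rewrite mxE mulrNz; ring.
Qed.

Lemma rboxN (h : 'rV[int]_d) : rbox alpha a (- h) = rbox alpha a h.
Proof.
apply: eq_bigr => j _; rewrite mxE /rbox1 oppr_eq0 mulrNz mulrN mulNr normrN.
by [].
Qed.

(** The weights are even and the functions at opposite frequencies are conjugate,
    so [h |-> - h] exchanges the two arguments. With hermitian symmetry this makes
    the kernel real valued. *)
Lemma Kbox_sym (x y : d.-tuple R) : Kbox alpha a x y = Kbox alpha a y x.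
Proof.
have bN : bijective (fun h : 'rV[int]_d => - h) by exists (fun h => - h) => h; exact: opprK.
have E h : (rbox alpha a (- h) ^- 2)%:C * phi a (- h) x * (phi a (- h) y)^* =
    (rbox alpha a h ^- 2)%:C * phi a h y * (phi a h x)^*.
  by rewrite rboxN !phiN conjCK -mulrA -[in RHS]mulrA [_^* * _]mulrC.
rewrite /Kbox /kkernel /csum; congr (_ +i* _).
  by rewrite -(rsum_reindex _ bN); apply: eq_rsum => h; rewrite E.
by rewrite -(rsum_reindex _ bN); apply: eq_rsum => h; rewrite E.
Qed.

Lemma KboxE (x y : d.-tuple R) :
  Kbox alpha a x y = trig_series (phi a) (kernel_coef (phi a) (rbox alpha a) x) y.
Proof. by rewrite Kbox_sym /Kbox kkernelE. Qed.

Lemma Im_Kbox (x y : d.-tuple R) : complex.Im (Kbox alpha a x y) = 0.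
Proof.
have on := bounded_orthonormal_phi.
have rs := rsummable_rbox alpha_gt0 a_gt0 d.
have r0 (h : 'rV[int]_d) : 0 < rbox alpha a h by exact: rbox_gt0.
have sc := wsummable_csummable r0 rs (wsummable_kernel on r0 rs x).
have K : (Kbox alpha a x y)^* = Kbox alpha a x y.
  rewrite {1}KboxE /trig_series -csum_conj; last exact: (trig_series_summable on y sc).
  apply: eq_csum => h.
  by rewrite /kernel_coef !rmorphM/= conjCK conj_real.
have := congr1 (@complex.Im R) K; rewrite Im_conj.
by move: (complex.Im _) => t; lra.
Qed.

End korobov_box.

(** * Variance of an average and effective dimension *)

(** The integral of a nonnegative function, measurable or not, is the supremum of
    the integrals of the simple functions below it, hence monotone. This applies to
    the squared error as a function of the sample. *)
Lemma ge0_le_integral_any d (T : measurableType d) (R : realType)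
    (mu : {measure set T -> \bar R}) (f g : T -> \bar R) :
  (forall x, 0 <= f x)%E -> (forall x, f x <= g x)%E ->
  (\int[mu]_x f x <= \int[mu]_x g x)%E.
Proof.
move=> f0 fg; have g0 x : (0 <= g x)%E by exact: le_trans (f0 x) (fg x).
rewrite !ge0_integralTE//; apply: le_ereal_sup => _ [h hf <-].
by exists h => // x; exact: le_trans (hf x) (fg x).
Qed.

Section average_of_independent.
Context (R : realType) (dO dT : measure_display) (Omega : measurableType dO)
  (T : measurableType dT) (P : probability Omega R) (M : nat)
  (Y : 'I_M -> {RV P >-> T}).
Hypothesis indep : mutually_independent Y.
Variables (u : T -> R) (l : R).
Hypotheses (bu : bmeas setT u) (lE : forall m, \int[P]_w u (Y m w) = l).

Let PT : (P setT < +oo)%E. Proof. by rewrite probability_setT ltry. Qed.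

Let bY m (v : T -> R) : bmeas setT v -> bmeas setT (fun w => v (Y m w)).
Proof.
exact: bmeas_comp.
Qed.

Let Ecst (k : R) : \int[P]_w (fun=> k) w = k.
Proof. by rewrite Rintegral_cst//= probability_setT mulr1. Qed.

Definition average w : R := M%:R^-1 * \sum_m u (Y m w).

Lemma bmeas_average : bmeas setT average.
Proof. by apply: bmeasZ; apply: bmeas_sum => m; exact: bY. Qed.

Lemma mean_average : (0 < M)%N -> \int[P]_w average w = l.
Proof.
move=> M0; rewrite (Rintegral_bmeasZ measurableT PT); last first.
  by apply: bmeas_sum => m; exact: bY.
rewrite (Rintegral_bmeas_sum measurableT PT); last by move=> m; exact: bY.
under eq_bigr do rewrite lE.
by rewrite sumr_const card_ord -[l *+ M]mulr_natl mulKf// pnatr_eq0 -lt0n.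
Qed.

(** Expanding the square, the terms with different indices vanish by independence
    and the others are variances, at most second moments. *)
Lemma mean_square_average : (0 < M)%N ->
  \int[P]_w (average w - l) ^+ 2 <=
  M%:R ^- 2 * \sum_m \int[P]_w (u (Y m w) ^+ 2).
Proof.
move=> M0; pose v x := u x + - l.
have bl : bmeas (setT : set T) (fun=> - l) by exact: bmeas_cst.
have bv : bmeas setT v by exact: bmeasD.
have Ev m : \int[P]_w v (Y m w) = 0.
  rewrite (Rintegral_bmeasD measurableT PT (bY m bu) (bY m bl)) lE Ecst.
  by rewrite subrr.
have E w : (average w - l) ^+ 2 =
    M%:R ^- 2 * \sum_m \sum_n (v (Y m w) * v (Y n w)).
  have -> : average w - l = M%:R^-1 * \sum_m v (Y m w).
    rewrite big_split/= sumr_const card_ord mulrDr; congr (_ + _).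
    by rewrite -[- l *+ M]mulr_natl mulKf// pnatr_eq0 -lt0n.
  rewrite exprMn exprVn; congr (_ * _); rewrite expr2 mulr_suml.
  by apply: eq_bigr => m _; rewrite mulr_sumr.
under eq_Rintegral do rewrite E.
have bvv m n : bmeas setT (fun w => v (Y m w) * v (Y n w)).
  by apply: bmeasM; exact: bY.
rewrite (Rintegral_bmeasZ measurableT PT); last first.
  by apply: bmeas_sum => m; exact: bmeas_sum.
apply: ler_wpM2l; first by rewrite invr_ge0 exprn_ge0.
rewrite (Rintegral_bmeas_sum measurableT PT); last by move=> m; exact: bmeas_sum.
apply: ler_sum => m _.
rewrite (Rintegral_bmeas_sum measurableT PT)// (bigD1 m)//= big1 ?addr0; last first.
  move=> n nm; rewrite (Rintegral_indep indep _ bv bv) 1?eq_sym// Ev mul0r//.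
have -> : \int[P]_w (v (Y m w) * v (Y m w)) =
    \int[P]_w (u (Y m w) ^+ 2 + (- (2 * l) * u (Y m w) + l ^+ 2)).
  by apply: eq_Rintegral => w _; rewrite /v; ring.
have bu2 : bmeas setT (fun w => u (Y m w) ^+ 2).
  by under eq_fun do rewrite expr2; apply: bmeasM; exact: bY.
have bul : bmeas setT (fun w => - (2 * l) * u (Y m w)) by apply: bmeasZ; exact: bY.
have bll : bmeas (setT : set Omega) (fun=> l ^+ 2) by exact: bmeas_cst.
rewrite (Rintegral_bmeasD measurableT PT bu2 (bmeasD bul bll)).
rewrite (Rintegral_bmeasD measurableT PT bul bll).
rewrite (Rintegral_bmeasZ measurableT PT _ (bY m bu)) lE Ecst.
have := sqr_ge0 l; move: (\int[P]_w _) => t; nra.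
Qed.

End average_of_independent.

Section effective_dimension.
Context (R : realType) (alpha d : nat) (a lambda tau : R).
Hypotheses (alpha_gt0 : (0 < alpha)%N) (a_gt0 : 0 < a) (lambda_gt0 : 0 < lambda)
  (tau_gt : 1 / (2 * alpha%:R) < tau) (tau_le1 : tau <= 1).

Let tau_gt0 : 0 < tau.
Proof. by apply: le_lt_trans tau_gt; rewrite divr_ge0// mulr_ge0. Qed.

Let atau : 1 < 2 * alpha%:R * tau.
Proof. by rewrite mulrC -ltr_pdivrMr// mulr_gt0// ltr0n. Qed.

Lemma powR_le_add1 (y t : R) : 0 < y -> 0 <= t <= 1 -> y `^ t <= 1 + y.
Proof.
move=> y0 /andP[t0 t1]; have [y1|/ltW y1] := leP 1 y.
  by apply: le_trans (ler1_powR y1 t1) _; lra.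
apply: (@le_trans _ _ 1); last by lra.
by rewrite -(powRr0 y); apply: ger_powR => //; rewrite y0.
Qed.

Let term (h : 'rV[int]_d) :
  ((2 * a)^-1 ^+ d) / (1 + lambda * rbox alpha a h ^+ 2) <=
  (lambda `^ (- tau) * (2 * a)^-1 ^+ d) * rbox alpha a h `^ (- (2 * tau)).
Proof.
have r0 := rbox_gt0 alpha a_gt0 h.
have y0 : 0 < lambda * rbox alpha a h ^+ 2 by rewrite mulr_gt0// exprn_gt0.
have -> : lambda `^ (- tau) * (2 * a)^-1 ^+ d * rbox alpha a h `^ (- (2 * tau)) =
    (2 * a)^-1 ^+ d * ((lambda * rbox alpha a h ^+ 2) `^ tau)^-1.
  rewrite powRM ?sqr_ge0//; last exact: ltW.
  rewrite -(powR_mulrn 2 (ltW r0)) -powRrM !powRN.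
  by rewrite [(_ `^ _ * _)^-1]invfM mulrAC mulrC.
apply: ler_wpM2l; first by rewrite exprn_ge0// invr_ge0 mulr_ge0// ltW.
rewrite lef_pV2 ?posrE ?powR_gt0//; last by rewrite addr_gt0.
by apply: powR_le_add1 => //; rewrite ltW.
Qed.

(** Termwise, [1 + y >= y ^ tau] for [y = lambda r^2] trades the resolvent for a
    power of the weights, whose sum over the lattice factorizes over coordinates. *)
Lemma effective_dimension_le :
  rsummable (fun h : 'rV[int]_d =>
    ((2 * a)^-1 ^+ d) / (1 + lambda * rbox alpha a h ^+ 2)) /\
  rsum (fun h : 'rV[int]_d =>
    ((2 * a)^-1 ^+ d) / (1 + lambda * rbox alpha a h ^+ 2)) <=
  ((2 * a) `^ (- tau - 1)
   + 1 / a * (a / pi) `^ (2 * alpha%:R * tau) * zeta (2 * alpha%:R * tau))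
    ^+ d / lambda `^ tau.
Proof.
have [s e] := rsum_rbox_powR a_gt0 d atau tau_gt0.
have sk := rsummableZ (lambda `^ (- tau) * (2 * a)^-1 ^+ d) s.
have t0 (h : 'rV[int]_d) :
    0 <= ((2 * a)^-1 ^+ d) / (1 + lambda * rbox alpha a h ^+ 2).
  apply: divr_ge0; first by rewrite exprn_ge0// invr_ge0 mulr_ge0// ltW.
  by rewrite addr_ge0// mulr_ge0 ?sqr_ge0// ltW.
have st : rsummable (fun h : 'rV[int]_d =>
    ((2 * a)^-1 ^+ d) / (1 + lambda * rbox alpha a h ^+ 2)).
  by apply: rsummable_le sk => h; rewrite ger0_norm//; exact: term.
split=> //; apply: le_trans (le_rsum st sk term) _.
rewrite rsumZ// e powRN -mulrA mulrC -exprMn; apply: ler_wpM2r.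
  by rewrite invr_ge0 powR_ge0.
rewrite le_eqVlt; apply/orP; left; apply/eqP; congr (_ ^+ _).
have a2 : 0 < 2 * a by rewrite mulr_gt0.
rewrite mulrDr powRB; last by apply/implyP => _; rewrite gt_eqF.
rewrite powRr1 ?(ltW a2)// mulrC; congr (_ + _).
by field; rewrite gt_eqF.
Qed.

End effective_dimension.

(** * Functions vanishing at the lattice points *)

Section lattice_bound.
Context (R : realType) (alpha d : nat) (a : R) (N : nat) (z : d.-tuple nat)
  (delta : R).
Hypotheses (alpha_gt0 : (0 < alpha)%N) (a_ge : 1 <= 2 * a)
  (lattice_bound : lattice_error_bound alpha N z delta).

Let a_gt0 : 0 < a. Proof. by move: a_ge; lra. Qed.

Definition box_of_unit (y : d.-tuple R) : d.-tuple R :=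
  [tuple 2 * a * tnth y j - a | j < d].

Lemma phi_scale (h : 'rV[int]_d) y :
  phi a h (box_of_unit y) = ((Num.sqrt (2 * a))^-1 ^+ d)%:C * epi h y.
Proof.
rewrite /phi big_split/= prodr_const card_ord -rmorphXn/=; congr (_ * _).
rewrite /epi /dot mulr_sumr expi_sum; apply: eq_bigr => j _.
by rewrite tnth_mktuple; congr expi; field; rewrite gt_eqF.
Qed.

Lemma lattice_point_unit k : unit_box (lattice_point R (N := N) z k).
Proof.
move=> j; rewrite tnth_mktuple /frac; set x := _ / _.
have := floor_itv x; rewrite intrD => /andP[x1 x2].
by rewrite subr_ge0 x1 lerBlDr addrC ltW.
Qed.

(** A function vanishing at the nodes is sent to zero by the lattice algorithm, so
    the error bound of the algorithm bounds the function itself. It is applied to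
    the function transported to the unit cube, whose coefficients are those of the
    original one up to the factor [(2 a)^(- d / 2)]; this factor occurs on both
    sides and cancels. *)
Lemma l2_le_of_vanishing (c : 'rV[int]_d -> R[i]) :
  wsummable (rbox alpha a) c ->
  (forall k : 'I_N, trig_series (phi a) c (scaled_point a z k : d.-tuple R) = 0) ->
  wform (fun=> 1) c c <=
  Ccst alpha delta d ^+ 2 *
    ((2 * a) ^+ (2 * alpha * d) * wform (fun h => rbox alpha a h ^+ 2) c c)
  / N%:R `^ (alpha%:R - 2 * delta).
Proof.
move=> sc c0.
have rs := rsummable_rbox alpha_gt0 a_gt0 d.
have r0 (h : 'rV[int]_d) : 0 < rbox alpha a h by exact: rbox_gt0.
have ssq := wsummable_sqabs r0 rs sc.
have on := bounded_orthonormal_epi R d.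
have us : rsummable (fun h : 'rV[int]_d => rweight alpha h ^- 2 : R).
  under eq_fun do rewrite rweight_rbox.
  exact: rsummable_rbox.
have u0 (h : 'rV[int]_d) : 0 < rweight alpha h :> R.
  by rewrite rweight_rbox; exact: rbox_gt0.
pose k0 : R := (Num.sqrt (2 * a))^-1 ^+ d.
pose q : R := (2 * a) ^+ (2 * alpha * d).
have k0_gt0 : 0 < k0 by rewrite exprn_gt0// invr_gt0 sqrtr_gt0 mulr_gt0.
pose g y := trig_series (phi a) c (box_of_unit y).
pose cg h := k0%:C * c h.
have gE y : g y = trig_series epi cg y.
  by apply: eq_csum => h; rewrite phi_scale mulrCA mulrA.
have wle h : sqabs (cg h) * rweight alpha h ^+ 2 <=
    (k0 ^+ 2 * q) * (sqabs (c h) * rbox alpha a h ^+ 2).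
  rewrite sqabsM sqabs_real.
  rewrite -[leLHS]mulrA -[leRHS]mulrA [q * _]mulrCA.
  apply: ler_wpM2l; first exact: sqr_ge0.
  apply: ler_wpM2l; first exact: sqabs_ge0.
  exact: rweight_le_rbox.
have scg : wsummable (rweight alpha) cg.
  apply: rsummable_le (rsummableZ (k0 ^+ 2 * q) sc) => h.
  by rewrite ger0_norm// mulr_ge0 ?sqabs_ge0 ?sqr_ge0.
have gH : Hunit alpha g.
  exact: (in_rkhs_series on u0 us scg (fun y _ => gE y)).
have gnorm : Hunit_norm alpha g ^+ 2 <=
    k0 ^+ 2 * q * wform (fun h => rbox alpha a h ^+ 2) c c.
  rewrite /Hunit_norm (sqr_knorm on u0 us scg (fun y _ => gE y)).
  by rewrite wform_sqabs -rsumZ//; apply: le_rsum => //; exact: rsummableZ.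
have alg0 y : lattice_alg alpha N z g y = 0.
  rewrite /lattice_alg fsbig1// => h _.
  rewrite big1 ?mulr0 ?mul0r// => k _.
  by rewrite /g -[box_of_unit _]/(scaled_point a z k) c0 mul0r.
have scg1 := wsummable_csummable u0 us scg.
have := lattice_bound gH; rewrite /l2norm.
have -> : \int[leb R d]_(y in unit_box) sqabs (g y - lattice_alg alpha N z g y) =
    k0 ^+ 2 * wform (fun=> 1) c c.
  transitivity (\int[leb R d]_(y in unit_box) sqabs (g y)).
    by apply: eq_Rintegral => y _; rewrite alg0 subr0.
  rewrite (Rintegral_sqabs on scg1 (fun y _ => gE y)).
  rewrite !wform_sqabs -rsumZ//; last first.
    by under eq_fun do rewrite mulr1.
  by apply: eq_rsum => h; rewrite sqabsM sqabs_real mulrA.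
have W0 : 0 <= wform (fun=> 1) c c.
  apply: wform_ge0 => //; rewrite /in_weighted_l2.
  by under eq_fun do rewrite mulr1.
set lhs := Num.sqrt _; set W := wform (fun h => rbox alpha a h ^+ 2) c c.
set C := Ccst _ _ _; set n := N%:R `^ _ => bound.
have lhs0 : 0 <= lhs by exact: sqrtr_ge0.
have b2 : lhs ^+ 2 <= (C * Hunit_norm alpha g * n) ^+ 2.
  by rewrite ler_pXn2r// nnegrE// (le_trans lhs0).
have n2 : n ^+ 2 = (N%:R `^ (alpha%:R - 2 * delta))^-1.
  rewrite /n -powR_mulrn ?powR_ge0// -powRrM -powRN; congr (_ `^ _).
  by field.
rewrite sqr_sqrtr in b2; last by rewrite mulr_ge0// sqr_ge0.
clearbody C; rewrite -(ler_pM2l (exprn_gt0 2 k0_gt0)); apply: le_trans b2 _.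
have -> : (C * Hunit_norm alpha g * n) ^+ 2 = C ^+ 2 * Hunit_norm alpha g ^+ 2 * n ^+ 2.
  by rewrite !exprMn.
rewrite n2 [leRHS]mulrA; apply: ler_wpM2r; first by rewrite invr_ge0 powR_ge0.
rewrite [leRHS]mulrCA; apply: ler_wpM2l; first exact: sqr_ge0.
by rewrite [leRHS]mulrA.
Qed.

End lattice_bound.

(** * Kernel least squares with lattice nodes *)

Section kernel_least_squares.
Context (R : realType) (d alpha : nat) (a : R).
Hypotheses (alpha_gt0 : (0 < alpha)%N) (a_gt0 : 0 < a).
Context (N : nat) (z : d.-tuple nat).

Let e := phi a (d := d).
Let r := rbox (R := R) alpha a (d := d).
Let on : bounded_orthonormal (box a) ((2 * a)^-1 ^+ d) e :=
  bounded_orthonormal_phi d a_gt0.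
Let rs : rsummable (fun h => r h ^- 2) := rsummable_rbox alpha_gt0 a_gt0 d.
Let r0 h : 0 < r h. Proof. exact: rbox_gt0. Qed.
Let r2_ge0 h : 0 <= r h ^+ 2. Proof. exact: sqr_ge0. Qed.
Let one_ge0 (h : 'rV[int]_d) : 0 <= 1 :> R. Proof. exact: ler01. Qed.

Definition node_coef (k : 'I_N) := kernel_coef e r (scaled_point a z k).

Lemma wsummable_node k : wsummable r (node_coef k).
Proof. exact: (wsummable_kernel on r0 rs). Qed.

Lemma wsummable_l2 c : wsummable r c -> in_weighted_l2 (fun=> 1) c.
Proof.
move=> sc; rewrite /in_weighted_l2; under eq_fun do rewrite mulr1.
exact: (wsummable_sqabs r0 rs sc).
Qed.

Definition VN_fun (t : 'rV[R]_N) (x : d.-tuple R) : R[i] :=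
  trig_series e (comb node_coef t) x.

Lemma wsummable_VN t : wsummable r (comb node_coef t).
Proof. by apply: in_weighted_l2_comb => // k; exact: wsummable_node. Qed.

Lemma VN_funE t x :
  VN_fun t x = \sum_k (t 0 k)%:C * Kbox alpha a (scaled_point a z k) x.
Proof.
rewrite /VN_fun (trig_series_comb on); last first.
  by move=> k; exact: (wsummable_csummable r0 rs (wsummable_node k)).
by apply: eq_bigr => k _; rewrite KboxE.
Qed.

Lemma VNP v : VN alpha N a z v <-> exists t, v = VN_fun t.
Proof.
split=> [[c ->]|[t ->]].
  exists (\row_k c k); apply/funext => x; rewrite VN_funE.
  by apply: eq_bigr => k _; rewrite mxE.
by exists (fun k => t 0 k); apply/funext => x; rewrite VN_funE.
Qed.

Lemma Im_VN_fun t x : complex.Im (VN_fun t x) = 0.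
Proof.
rewrite VN_funE Im_sum big1// => k _.
by rewrite Im_mul Im_Kbox//= mulr0 mul0r addr0.
Qed.

Definition VN_val t x : R := complex.Re (VN_fun t x).

Lemma VN_val_sum n (k : 'I_n -> R) (t : 'I_n -> 'rV[R]_N) x :
  VN_val (\sum_i k i *: t i) x = \sum_i k i * VN_val (t i) x.
Proof.
have E s : VN_val s x = \sum_k s 0 k * complex.Re (Kbox alpha a (scaled_point a z k) x).
  rewrite /VN_val VN_funE Re_sum; apply: eq_bigr => j _.
  by rewrite Re_mul /= mul0r subr0.
rewrite E; under [RHS]eq_bigr do rewrite E mulr_sumr.
rewrite exchange_big; apply: eq_bigr => j _ /=.
rewrite summxE mulr_suml; apply: eq_bigr => i _.
by rewrite mxE mulrA.
Qed.

Lemma bmeas_VN_val t : bmeas setT (VN_val t).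
Proof.
exact: (cbmeas_trig_series on (wsummable_csummable r0 rs (wsummable_VN t))).1.
Qed.

(** The inner products of L^2 and of the Korobov space, in coordinates. *)
Definition VN_L2 (t t' : 'rV[R]_N) :=
  wform (fun=> 1) (comb node_coef t) (comb node_coef t').
Definition VN_K (t t' : 'rV[R]_N) :=
  wform (fun h => r h ^+ 2) (comb node_coef t) (comb node_coef t').

Lemma semi_inner_L2 : semi_inner VN_L2.
Proof. by apply: semi_inner_wform => // k; exact/wsummable_l2/wsummable_node. Qed.

Lemma semi_inner_K : semi_inner VN_K.
Proof. by apply: semi_inner_wform => // k; exact: wsummable_node. Qed.

Lemma Re_VN_inner lambda t t' :
  complex.Re (l2inner (box a) (VN_fun t) (VN_fun t') +
    lambda%:C * Hbox_inner alpha a (VN_fun t) (VN_fun t')) =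
  reg_form VN_L2 VN_K lambda t t'.
Proof.
have s := wsummable_VN t; have s' := wsummable_VN t'.
have cs := wsummable_csummable r0 rs s; have cs' := wsummable_csummable r0 rs s'.
have -> : complex.Re (l2inner (box a) (VN_fun t) (VN_fun t') +
    lambda%:C * Hbox_inner alpha a (VN_fun t) (VN_fun t')) =
    complex.Re (l2inner (box a) (VN_fun t) (VN_fun t')) +
    lambda * complex.Re (Hbox_inner alpha a (VN_fun t) (VN_fun t')).
  by rewrite Re_add Re_mul [complex.Im lambda%:C]/= mul0r subr0.
congr (_ + _ * _).
  exact: (Re_l2inner on cs cs' (fun _ _ => erefl) (fun _ _ => erefl)).
exact: (Re_kinner on r0 rs s s' (fun _ _ => erefl) (fun _ _ => erefl)).
Qed.

Section christoffel.
Variables (lambda : R).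
Hypothesis lambda_gt0 : 0 < lambda.
Variables (m : nat) (b : 'I_m -> 'rV[R]_N).
Hypothesis onb : orthonormal (reg_form VN_L2 VN_K lambda) b.

Let w h := 1 + lambda * r h ^+ 2.

(** The left-hand side is the largest value of [v x ^ 2] over the [v] in the span
    of the basis and in the unit ball of the regularized form, and the right-hand
    side is the same quantity for all series. The extremal function is the [t]
    below: the form and the evaluation at [x] take the same value on it, so
    [Re_trig_series_le] bounds this value. *)
Lemma christoffel_le x : rsummable (fun h => (2 * a)^-1 ^+ d / w h) ->
  \sum_i VN_val (b i) x ^+ 2 <= rsum (fun h => (2 * a)^-1 ^+ d / w h).
Proof.
move=> sw; pose t := \sum_i VN_val (b i) x *: b i.
have siB := semi_inner_reg semi_inner_L2 semi_inner_K lambda_gt0.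
have tE : VN_val t x = \sum_i VN_val (b i) x ^+ 2.
  by rewrite VN_val_sum; apply: eq_bigr => i _; rewrite expr2.
have sc := wsummable_VN t.
have w0 h : 0 < w h by rewrite ltr_pwDl// mulr_ge0// ltW.
have sl2 := wsummable_l2 sc.
have swc : in_weighted_l2 w (comb node_coef t).
  rewrite /in_weighted_l2; under eq_fun do rewrite mulrDr mulrCA.
  by apply: rsummableD => //; exact: rsummableZ.
have Bt : wform w (comb node_coef t) (comb node_coef t) =
    \sum_i VN_val (b i) x ^+ 2.
  have -> : wform w (comb node_coef t) (comb node_coef t) =
      reg_form VN_L2 VN_K lambda t t.
    rewrite /reg_form /VN_L2 /VN_K !wform_sqabs -rsumZ// -rsumD//; last exact: rsummableZ.
    by apply: eq_rsum => h; rewrite mulrDr mulrCA.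
  rewrite {1}/t (si_suml siB); apply: eq_bigr => i _.
  rewrite [reg_form _ _ _ (b i) t](siC siB) /t (si_orthonormal_suml siB)//.
have := Re_trig_series_le on x w0 (wsummable_csummable r0 rs sc) swc sw.
rewrite Bt -[trig_series _ _ _]/(VN_fun t x) -/(VN_val t x) tE.
by move: (\sum_i _) (rsum _) => s1 s2; lra.
Qed.

End christoffel.

Section target.
Variable f : d.-tuple R -> R.
Hypothesis hf : Hbox alpha a (fun x => (f x)%:C).

Definition target_coef : 'rV[int]_d -> R[i] :=
  fcoef (box a) e (fun x => (f x)%:C).

Lemma wsummable_target : wsummable r target_coef.
Proof. exact: (in_rkhs_coef on r0 rs hf).1. Qed.

Lemma targetE x : box a x -> (f x)%:C = trig_series e target_coef x.
Proof. exact: (in_rkhs_coef on r0 rs hf).2. Qed.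

Let sf := wsummable_target.
Let cf := wsummable_csummable r0 rs sf.

Lemma bmeas_target : bmeas (box a) f.
Proof.
have [[m [M bM]] _] := cbmeasS (box a) (cbmeas_trig_series on cf).
have E x : box a x -> f x = complex.Re (trig_series e target_coef x).
  by move=> /targetE <-.
split; last by exists M => x Dx; rewrite E//; exact: bM.
by apply: eq_measurable_fun m => x /[!inE] /E ->.
Qed.

Definition target_L2 t := wform (fun=> 1) target_coef (comb node_coef t).
Definition target_K t := wform (fun h => r h ^+ 2) target_coef (comb node_coef t).
Definition target_L2sq := wform (fun=> 1) target_coef target_coef.

Lemma target_L2E t : target_L2 t = \int[leb R d]_(x in box a) (f x * VN_val t x).
Proof.
have ct := wsummable_csummable r0 rs (wsummable_VN t).
rewrite /target_L2 -(Re_l2inner on cf ct targetE (fun _ _ => erefl)).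
transitivity (\int[leb R d]_(x in box a)
    complex.Re ((f x)%:C * (VN_fun t x)^*)); first by [].
apply: eq_Rintegral => x _; rewrite Re_mul Re_conj Im_conj.
by rewrite [complex.Im (f x)%:C]/= mul0r subr0.
Qed.

Lemma target_Ksq : wform (fun h => r h ^+ 2) target_coef target_coef =
  Hbox_norm alpha a (fun x => (f x)%:C) ^+ 2.
Proof.
by rewrite wform_sqabs /Hbox_norm (sqr_knorm on r0 rs sf targetE).
Qed.

Lemma integral_sqabs_VN t :
  (\int[leb R d]_(x in box a) (sqabs (VN_fun t x - (f x)%:C))%:E =
   (sqdist VN_L2 target_L2 target_L2sq t)%:E)%E.
Proof.
have st := wsummable_VN t; have ct := wsummable_csummable r0 rs st.
pose c h := target_coef h + -1 * comb node_coef t h.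
have sc : wsummable r c.
  by apply: in_weighted_l2_sub => // k; exact: wsummable_node.
have cc := wsummable_csummable r0 rs sc.
have E x : box a x -> (f x)%:C - VN_fun t x = trig_series e c x.
  by move=> Dx; rewrite (trig_seriesD on)// -targetE.
transitivity (\int[leb R d]_(x in box a) (sqabs ((f x)%:C - VN_fun t x))%:E)%E.
  apply: eq_integral => x _; congr (_%:E).
  by rewrite -opprB -sqr_normc_sqabs normcN sqr_normc_sqabs.
rewrite -(EFin_Rintegral (on_measurable on) (on_finite on)); last first.
  exact: (bmeas_sqabs on cc E).
rewrite (Rintegral_sqabs on cc E) /c wform_sub_comb//.
- by move=> k; exact/wsummable_l2/wsummable_node.
- exact: wsummable_l2.
Qed.

Lemma target_L2_ge0 t : 0 <= target_L2sq - 2 * target_L2 t + VN_L2 t t.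
Proof.
rewrite /target_L2sq /target_L2 /VN_L2 -wform_sub_comb//.
- apply: wform_ge0 => //; apply: in_weighted_l2_sub => //.
  + by move=> k; exact/wsummable_l2/wsummable_node.
  + exact: wsummable_l2.
- by move=> k; exact/wsummable_l2/wsummable_node.
- exact: wsummable_l2.
Qed.

Lemma target_K_ge0 t : 0 <=
  wform (fun h => r h ^+ 2) target_coef target_coef - 2 * target_K t + VN_K t t.
Proof.
rewrite /target_K /VN_K -wform_sub_comb//; last first.
  by move=> k; exact: wsummable_node.
apply: wform_ge0 => //; apply: in_weighted_l2_sub => // k.
exact: wsummable_node.
Qed.

(** The orthogonal projection of the target onto [VN] in the Korobov space. By the
    reproducing property it interpolates the target at the nodes, and neither it
    nor the error has a larger norm than the target. *)
Lemma interpolant (delta : R) : 1 <= 2 * a -> lattice_error_bound alpha N z delta ->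
  exists p, VN_K p p <= Hbox_norm alpha a (fun x => (f x)%:C) ^+ 2 /\
    sqdist VN_L2 target_L2 target_L2sq p <=
    Ccst alpha delta d ^+ 2 *
      ((2 * a) ^+ (2 * alpha * d) * Hbox_norm alpha a (fun x => (f x)%:C) ^+ 2)
    / N%:R `^ (alpha%:R - 2 * delta).
Proof.
move=> a1 hC.
have siK := semi_inner_K.
have KD t t' : target_K (t + t') = target_K t + target_K t'.
  by apply: wform_combDr => // k; exact: wsummable_node.
have KZ k t : target_K (k *: t) = k * target_K t.
  by apply: wform_combZr => // j; exact: wsummable_node.
have [m [b [onb res]]] := orthonormal_basis siK.
pose p := \sum_i target_K (b i) *: b i.
have pE t : VN_K p t = target_K t by exact: (riesz siK KD KZ target_K_ge0 onb res).
have FK := target_Ksq.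
have pF : VN_K p p <= Hbox_norm alpha a (fun x => (f x)%:C) ^+ 2.
  by have := target_K_ge0 p; rewrite -pE FK; lra.
exists p; split=> //.
pose c h := target_coef h + -1 * comb node_coef p h.
have sc : wsummable r c.
  by apply: in_weighted_l2_sub => // k; exact: wsummable_node.
have -> : sqdist VN_L2 target_L2 target_L2sq p = wform (fun=> 1) c c.
  rewrite /c wform_sub_comb//.
  - by move=> k; exact/wsummable_l2/wsummable_node.
  - exact: wsummable_l2.
have Kc : wform (fun h => r h ^+ 2) c c <= Hbox_norm alpha a (fun x => (f x)%:C) ^+ 2.
  rewrite /c wform_sub_comb//; last by move=> k; exact: wsummable_node.
  rewrite -/(target_K p) -/(VN_K p p) -pE FK.
  by have := si_ge0 siK p; lra.
have vanish (k : 'I_N) : trig_series e c (scaled_point a z k) = 0.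
  have cp := wsummable_csummable r0 rs (wsummable_VN p).
  have boxk : box a (scaled_point (R := R) (N := N) a z k).
    move=> j; have yk := lattice_point_unit R z k j; rewrite tnth_mktuple.
    move: (tnth (lattice_point R z k) j) yk => y /andP[y0 y1].
    have ay0 := mulr_ge0 (ltW a_gt0) y0.
    have ay1 : 0 <= a * (1 - y) by rewrite mulr_ge0 ?subr_ge0// ltW.
    by apply/andP; split; move: ay0 ay1; rewrite mulrBr mulr1 -mulrA; lra.
  apply: complex_eq.
    rewrite (Re_trig_series_kernel e r0) -/(node_coef k).
    pose t : 'rV[R]_N := delta_mx 0 k.
    have -> : node_coef k = comb node_coef t.
      apply/funext => h; rewrite /comb (bigD1 k)//= big1 ?addr0.
        by rewrite mxE !eqxx mul1r.
      by move=> j jk; rewrite mxE (negbTE jk) andbF mul0r.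
    have scp := wsummable_VN p; have sct := wsummable_VN t.
    have sN : in_weighted_l2 (fun h => r h ^+ 2) (fun h => (-1)%:C * comb node_coef p h).
      exact: in_weighted_l2Z.
    have -> : c = fun h => target_coef h + (-1)%:C * comb node_coef p h.
      by apply/funext => h; rewrite /c rmorphN1.
    rewrite wformDl// wformZl//.
    rewrite -/(target_K t) -/(VN_K p t) pE /=; ring.
  rewrite (trig_seriesD on)// -targetE// -/(VN_fun p _).
  have Im_opp (x : R[i]) : complex.Im (- x) = - complex.Im x by case: x.
  by rewrite Im_add Im_opp Im_VN_fun oppr0 addr0.
apply: le_trans (l2_le_of_vanishing alpha_gt0 a1 hC sc vanish) _.
apply: ler_wpM2r; first by rewrite invr_ge0 powR_ge0.
apply: ler_wpM2l; first exact: sqr_ge0.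
apply: ler_wpM2l => //; apply: exprn_ge0; exact: le_trans ler01 a1.
Qed.

End target.
End kernel_least_squares.

(** * The mean integrated squared error *)

Local Open Scope complex_scope.

Theorem theorem3p10 (R : realType) (d alpha : nat) (a : R)
  (hd : (0 < d)%N) (halpha : (0 < alpha)%N) (ha : 1 / 2 <= a)
  (f : d.-tuple R -> R)
  (hf : Hbox alpha a (fun x => (f x)%:C))
  (hf_density : is_density_on (box a) f)
  (dO : measure_display) (Omega : measurableType dO) (P : probability Omega R)
  (M : nat) (hM : (0 < M)%N) (Y : 'I_M -> {RV P >-> d.-tuple R})
  (hY_density : forall m, has_density_on (box a) f (Y m))
  (hY_indep : mutually_independent Y)
  (N : nat) (hN : prime N) (z : d.-tuple nat) (hz : cbc_vector R alpha N z)
  (lambda : R) (hlambda : 0 < lambda < 1)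
  (fY : Omega -> d.-tuple R -> R[i])
  (hfY_VN : forall w, VN alpha N a z (fY w))
  (hfY : forall w v, VN alpha N a z v ->
     l2inner (box a) (fY w) v +
     lambda%:C * Hbox_inner alpha a (fY w) v
     = M%:R^-1 * \sum_(m < M) v (Y m w))
  (tau : R) (htau : 1 / (2 * alpha%:R) < tau <= 1)
  (delta : R) (hdelta : 0 < delta < alpha%:R / 2)
  (hCKNS : lattice_error_bound alpha N z delta) :
  (\int[P]_w \int[leb R d]_(x in box a) (sqabs (fY w x - (f x)%:C))%:E
   <= (Ccst alpha delta d ^+ 2 *
         ((2 * a) ^+ (2 * alpha * d) *
          Hbox_norm alpha a (fun x => (f x)%:C) ^+ 2)
         / N%:R `^ (alpha%:R - 2 * delta)
       + lambda * Hbox_norm alpha a (fun x => (f x)%:C) ^+ 2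
       + ((2 * a) `^ (- tau - 1)
          + 1 / a * (a / pi) `^ (2 * alpha%:R * tau) * zeta (2 * alpha%:R * tau))
           ^+ d / (M%:R * lambda `^ tau))%:E)%E.
Proof.
have a_gt0 : 0 < a by apply: lt_le_trans ha; rewrite divr_gt0.
have a1 : 1 <= 2 * a by move: ha; lra.
have [lambda_gt0 _] := andP hlambda.
have [tau_gt tau_le1] := andP htau.
pose L := VN_L2 alpha a (N := N) z; pose K := VN_K alpha a (N := N) z.
pose l := target_L2 alpha a (N := N) z f; pose F := target_L2sq a f.
have siL : semi_inner L := semi_inner_L2 halpha a_gt0 N z.
have siK : semi_inner K := semi_inner_K halpha a_gt0 N z.
have siB := semi_inner_reg siL siK lambda_gt0.
have lD s t : l (s + t) = l s + l t.
  apply: wform_combDr => [h|k|]; first exact: ler01.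
    exact: (wsummable_l2 halpha a_gt0 (wsummable_node halpha a_gt0 z k)).
  exact: (wsummable_l2 halpha a_gt0 (wsummable_target halpha a_gt0 hf)).
have lZ k t : l (k *: t) = k * l t.
  apply: wform_combZr => [h|j|]; first exact: ler01.
    exact: (wsummable_l2 halpha a_gt0 (wsummable_node halpha a_gt0 z j)).
  exact: (wsummable_l2 halpha a_gt0 (wsummable_target halpha a_gt0 hf)).
have lF : forall t, 0 <= F - 2 * l t + L t t := target_L2_ge0 halpha a_gt0 z hf.
have [n [b [onb res]]] := orthonormal_basis siB.
pose u i := VN_val alpha a (N := N) z (b i).
have bu i : bmeas setT (u i) := bmeas_VN_val halpha a_gt0 z (b i).
pose ev w t := average Y (VN_val alpha a (N := N) z t) w.
have /choice[t tE] w := (VNP halpha a_gt0 N z (fY w)).1 (hfY_VN w).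
have galerkin w s : reg_form L K lambda (t w) s = ev w s.
  rewrite -(Re_VN_inner halpha a_gt0 z) -tE hfY; last first.
    by apply/(VNP halpha a_gt0 N z); exists s.
  have -> : (M%:R : R[i])^-1 = (M%:R^-1)%:C by rewrite fmorphV rmorph_nat.
  rewrite Re_mul [complex.Im _%:C]/= mul0r subr0 [complex.Re _%:C]/=.
  by rewrite Re_sum.
pose eta i w := average Y (u i) w.
pose T i := L (b i) (mean_fit l b) - l (b i).
pose G := sqdist L l F (mean_fit l b).
(* pointwise in the sample: variance term, centered cross term and bias [G] *)
pose bound w := \sum_i (eta i w - l (b i)) ^+ 2
  + (2 * (\sum_i (eta i w - l (b i)) * T i) + G).
have inner w : (\int[leb R d]_(x in box a) (sqabs (fY w x - (f x)%:C))%:E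
    <= (bound w)%:E)%E.
  rewrite tE (integral_sqabs_VN halpha a_gt0 z hf) lee_fin.
  rewrite -/L -/l -/F (sqdist_galerkin siL siK lambda_gt0 lD lZ lF res (galerkin w)).
  by rewrite /bound addrA; exact: (sqdist_fit_le siL siK lambda_gt0 F lD lZ onb).
apply: (@le_trans _ _ (\int[P]_w (bound w)%:E)%E).
  apply: ge0_le_integral_any => w; last exact: inner.
  by apply: integral_ge0 => x _; rewrite lee_fin sqabs_ge0.
have PT : (P setT < +oo)%E by rewrite probability_setT ltry.
have Ecst (k : R) : \int[P]_w (fun=> k) w = k.
  by rewrite Rintegral_cst//= probability_setT mulr1.
have beta i : bmeas setT (eta i) := bmeas_average Y (bu i).
have bdev i : bmeas setT (fun w => eta i w - l (b i)).
  by apply: bmeasD => //; exact: bmeas_cst.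
have bdev2 i : bmeas setT (fun w => (eta i w - l (b i)) ^+ 2).
  by under eq_fun do rewrite expr2; exact: bmeasM.
have bdevT i : bmeas setT (fun w => (eta i w - l (b i)) * T i).
  by apply: bmeasM => //; exact: bmeas_cst.
have b1 : bmeas setT (fun w => \sum_i (eta i w - l (b i)) ^+ 2) by exact: bmeas_sum.
have b2 : bmeas setT (fun w => 2 * (\sum_i (eta i w - l (b i)) * T i)).
  by apply: bmeasZ; exact: bmeas_sum.
have b3 : bmeas (setT : set Omega) (fun=> G) by exact: bmeas_cst.
rewrite -(EFin_Rintegral measurableT PT (bmeasD b1 (bmeasD b2 b3))) lee_fin.
rewrite (Rintegral_bmeasD measurableT PT b1 (bmeasD b2 b3)).
rewrite (Rintegral_bmeasD measurableT PT b2 b3) Ecst.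
have bo := on_measurable (bounded_orthonormal_phi d a_gt0).
have bf := on_finite (bounded_orthonormal_phi d a_gt0).
have lE i m : \int[P]_w u i (Y m w) = l (b i).
  rewrite (Rintegral_density bo bf (bmeas_target halpha a_gt0 hf)
    (hY_density m) (bu i)).
  by rewrite -(target_L2E halpha a_gt0 z hf).
have cross0 : \int[P]_w (2 * (\sum_i (eta i w - l (b i)) * T i)) = 0.
  rewrite (Rintegral_bmeasZ measurableT PT); last exact: bmeas_sum.
  rewrite (Rintegral_bmeas_sum measurableT PT)// big1 ?mulr0// => i _.
  under eq_Rintegral do rewrite mulrC.
  rewrite (Rintegral_bmeasZ measurableT PT)//.
  rewrite (Rintegral_bmeasD measurableT PT (beta i) (bmeas_cst _ _)).
  by rewrite (mean_average (bu i) (lE i) hM) Ecst subrr mulr0.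
rewrite cross0 add0r addrC.
(* the bias gives the first two terms of the bound and the variance the third *)
have [sw wle] := effective_dimension_le d halpha a_gt0 lambda_gt0 tau_gt tau_le1.
apply: lerD.
  have [p [Kp Lp]] := interpolant halpha a_gt0 hf a1 hCKNS.
  have := mean_fit_min siL siK lambda_gt0 lD lZ lF onb res p.
  rewrite -/G => Gp.
  have K0 : 0 <= lambda * K (mean_fit l b) (mean_fit l b).
    by rewrite mulr_ge0 ?(si_ge0 siK)// ltW.
  have Gp' : G <= sqdist L l F p + lambda * K p p.
    by apply: le_trans Gp; rewrite lerDl.
  apply: le_trans Gp' (lerD Lp _).
  by apply: ler_wpM2l Kp; exact: ltW.
rewrite (Rintegral_bmeas_sum measurableT PT)//.
apply: (@le_trans _ _ (\sum_i (M%:R ^- 2 * \sum_m \int[P]_w (u i (Y m w) ^+ 2)))).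
  by apply: ler_sum => i _; exact: (mean_square_average hY_indep (bu i) (lE i) hM).
rewrite -mulr_sumr exchange_big/=.
set Q := (2 * a) `^ (- tau - 1) + _ in wle *.
pose C0 := Q ^+ d / lambda `^ tau.
have bu2 i m : bmeas setT (fun w => u i (Y m w) ^+ 2).
  under eq_fun do rewrite expr2.
  have buY : bmeas setT (fun w => u i (Y m w)) by exact: bmeas_comp.
  exact: bmeasM.
have each m : \sum_i \int[P]_w (u i (Y m w) ^+ 2) <= C0.
  rewrite -(Rintegral_bmeas_sum measurableT PT)//.
  rewrite -(Ecst C0); apply: le_Rintegral => //.
  - by apply: (bmeas_integrable measurableT PT); exact: bmeas_sum.
  - exact: (bmeas_integrable measurableT PT (bmeas_cst _ _)).
  - move=> w _; apply: (le_trans _ wle).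
    exact: (christoffel_le halpha a_gt0 lambda_gt0 onb).
apply: (@le_trans _ _ (M%:R ^- 2 * \sum_(m < M) C0)).
  apply: ler_wpM2l; first by rewrite invr_ge0 exprn_ge0.
  by apply: ler_sum => m _; exact: each.
have Mn0 : M%:R != 0 :> R by rewrite pnatr_eq0 -lt0n.
have ln0 : lambda `^ tau != 0 by rewrite gt_eqF// powR_gt0.
rewrite sumr_const card_ord -[C0 *+ M]mulr_natl /C0.
rewrite le_eqVlt; apply/orP; left; apply/eqP; field.
by rewrite Mn0 ln0.
Qed.
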